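(* Let $J\geq2$ be an integer, let $\mathrm{B}$ be a symplectic form on a vector space $\mathcal{V}$ over $\mathbb{F}_2$ of dimension $2J$, and let $\mathcal{D}$ be an affine quadric in $\mathcal{V}$ with $\#(\mathcal{D})=2^{J-1}(2^J+1)$ and complement $\mathcal{D}^{\mathrm{c}}$. Let $\Psi$, $\Psi_{\mathcal{D}}$ and $\widehat{\Phi}_{\mathcal{D}^{\mathrm{c}}}$ be the ETFs defined in the context. Then: (1) $\operatorname{bin}(\Psi)=\{v+\mathcal{L}: v\in\mathcal{V},\ \mathcal{L}\subseteq\mathcal{V},\ \mathcal{L}^\perp=\mathcal{L}\}$ is the set of all affine Lagrangian subspaces of $\mathcal{V}$, which forms a BIBD (over the vertex set $\mathcal{V}$) with $(V,K,\Lambda,R,B)$ parameters \[2^{2J},\quad 2^J,\quad \prod_{j=1}^{J-1}(2^j+1),\quad \prod_{j=1}^{J}(2^j+1),\quad 2^J\prod_{j=1}^{J}(2^j+1),\] respectively. (2) Any Lagrangian subspace of $\mathcal{V}$ has a unique coset that lies in $\mathcal{D}$, and so $\operatorname{bin}(\Psi_{\mathcal{D}})=\{v+\mathcal{L}\in\operatorname{bin}(\Psi): v+\mathcal{L}\subseteq\mathcal{D}\}$ forms a BIBD (over $\mathcal{D}$) with $(V_{\mathcal{D}},K_{\mathcal{D}},\Lambda_{\mathcal{D}},R_{\mathcal{D}},B_{\mathcal{D}})$ parameters \[2^{J-1}(2^J+1),\quad 2^J,\quad \prod_{j=0}^{J-2}(2^j+1),\quad \prod_{j=0}^{J-1}(2^j+1),\quad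 \prod_{j=1}^{J}(2^j+1),\] respectively. (3) The $\mathcal{D}^{\mathrm{c}}$-components of the affine Lagrangian subspaces of $\mathcal{V}$ that do not lie in $\mathcal{D}$, i.e., \[\{(v+\mathcal{L})\cap\mathcal{D}^{\mathrm{c}}: v+\mathcal{L}\in\operatorname{bin}(\Psi),\ v+\mathcal{L}\nsubseteq\mathcal{D}\},\] form a BIBD (over $\mathcal{D}^{\mathrm{c}}$) with $(V_{\mathcal{D}^{\mathrm{c}}},K_{\mathcal{D}^{\mathrm{c}}},\Lambda_{\mathcal{D}^{\mathrm{c}}},R_{\mathcal{D}^{\mathrm{c}}},B_{\mathcal{D}^{\mathrm{c}}})$ parameters \[2^{J-1}(2^J-1),\quad 2^{J-1},\quad \prod_{j=2}^{J-1}(2^j+1),\quad \prod_{j=2}^{J}(2^j+1),\quad (2^J-1)\prod_{j=2}^{J}(2^j+1),\] respectively. This set is $\operatorname{bin}(\widehat{\Phi}_{\mathcal{D}^{\mathrm{c}}})$, and each member of it extends to exactly three members of $\operatorname{bin}(\Psi)\setminus\operatorname{bin}(\Psi_{\mathcal{D}})$ (that is, it equals $\mathcal{M}\cap\mathcal{D}^{\mathrm{c}}$ for exactly three $\mathcal{M}\in\operatorname{bin}(\Psi)\setminus\operatorname{bin}(\Psi_{\mathcal{D}})$). (4) The $\mathcal{D}$-components of these affine Lagrangian subspaces, i.e., \[\{(v+\mathcal{L})\cap\mathcal{D}: v+\mathcal{L}\in\operatorname{bin}(\Psi),\ v+\mathcal{L}\nsubseteq\mathcal{D}\},\] form a BIBD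 over the vertex set $\mathcal{D}$ whose parameters $(V_0,K_0,\Lambda_0,R_0,B_0)$ are \[2^{J-1}(2^J+1),\quad 2^{J-1},\quad (2^{J-1}-1)\prod_{j=1}^{J-2}(2^j+1),\quad (2^J-1)\prod_{j=1}^{J-1}(2^j+1),\quad (2^J-1)\prod_{j=1}^{J}(2^j+1),\] respectively. (5) The incidence matrices $\mathbf{X}$, $\mathbf{X}_{\mathcal{D}}$, $\mathbf{X}_{\mathcal{D}^{\mathrm{c}}}$ and $\mathbf{X}_0$ of the BIBDs of (1), (2), (3) and (4), respectively, satisfy \[\mathbf{X}=\begin{bmatrix}\mathbf{X}_{\mathcal{D}^{\mathrm{c}}}\otimes\left[\begin{smallmatrix}1\\1\\1\end{smallmatrix}\right] & \mathbf{X}_0\\ \mathbf{0} & \mathbf{X}_{\mathcal{D}}\end{bmatrix},\] provided the columns of $\mathbf{X}$ are indexed in ''$\mathcal{D}^{\mathrm{c}}$ then $\mathcal{D}$'' order, while its rows are arranged according to the intersection of their blocks with $\mathcal{D}^{\mathrm{c}}$, beginning with those with nonempty such intersections (with the rows of the other matrices ordered accordingly).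
   Context: A symplectic form is an alternating nondegenerate bilinear form. For $\mathcal{S}\subseteq\mathcal{V}$, $\mathcal{S}^\perp=\{v_2\in\mathcal{V}:\mathrm{B}(v_1,v_2)=0\ \forall v_1\in\mathcal{S}\}$; a Lagrangian subspace is a subset $\mathcal{L}$ (necessarily a subspace) with $\mathcal{L}=\mathcal{L}^\perp$. A function $\mathrm{Q}:\mathcal{V}\to\mathbb{F}_2$ is a quadratic form that yields $\mathrm{B}$ if $\mathrm{B}(v_1,v_2)=\mathrm{Q}(v_1+v_2)+\mathrm{Q}(v_1)+\mathrm{Q}(v_2)$ for all $v_1,v_2\in\mathcal{V}$; its quadric is $\{v\in\mathcal{V}:\mathrm{Q}(v)=0\}$. A subset $\mathcal{D}\subseteq\mathcal{V}$ is an affine quadric if either $\mathcal{D}$ or its complement is the quadric of some quadratic form that yields $\mathrm{B}$. Empty products equal $1$. ETFs: a finite sequence $(\varphi_n)_{n\in\mathcal{N}}$ in a real Hilbert space ($\mathcal{N}$ finite, nonempty) is an equiangular tight frame (ETF) if $\|\varphi_n\|^2=S$ for all $n$ for some $S>0$, $|\langle\varphi_{n_1},\varphi_{n_2}\rangle|^2=C$ for all $n_1\neq n_2$ for some $C>0$, and for some $A>0$, $\sum_n\langle\varphi_n,y\rangle\varphi_n=Ay$ for all $y$ in its span. For nonempty $\mathcal{K}\subseteq\mathcal{N}$, $(\varphi_n)_{n\in\mathcal{K}}$ is a regular simplex if it is an ETF whose span has dimension $\#(\mathcal{K})-1$. The binder of an ETF $(\varphi_n)_{n\in\mathcal{N}}$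 is the set of all $\mathcal{K}\subseteq\mathcal{N}$ such that $(\varphi_n)_{n\in\mathcal{K}}$ is a regular simplex. The sequences: $\Psi=(\psi_v)_{v\in\mathcal{V}}$ in $\mathbb{R}^{\mathcal{D}^{\mathrm{c}}}$ is given by $\psi_{v_2}(v_1)=2^{-(J-1)/2}(-1)^{\mathrm{B}(v_1,v_2)}$ for $v_1\in\mathcal{D}^{\mathrm{c}}$, $v_2\in\mathcal{V}$, and $\Psi_{\mathcal{D}}=(\psi_v)_{v\in\mathcal{D}}$. $\widehat{\Phi}_{\mathcal{D}^{\mathrm{c}}}=(\widehat{\varphi}_v)_{v\in\mathcal{D}^{\mathrm{c}}}$ is a sequence in a real Hilbert space (unique up to isometry of spans) with $\langle\widehat{\varphi}_{v_1},\widehat{\varphi}_{v_2}\rangle=2^{J-1}-1$ if $v_1=v_2$ and $-(-1)^{\mathrm{B}(v_1,v_2)}$ if $v_1\neq v_2$. (It is the dual of $\Phi_{\mathcal{D}^{\mathrm{c}}}=(\varphi_v)_{v\in\mathcal{D}^{\mathrm{c}}}$, where $\varphi_{v_2}\in\mathbb{R}^{\mathcal{D}}$, $\varphi_{v_2}(v_1)=2^{-(J-1)/2}(-1)^{\mathrm{B}(v_1,v_2)}$.) It is known that $\Psi$, $\Psi_{\mathcal{D}}$ and $\widehat{\Phi}_{\mathcal{D}^{\mathrm{c}}}$ are ETFs whose spans have dimensions $2^{J-1}(2^J-1)$, $\frac13(2^{2J}-1)$ and $\frac13(2^{J-1}-1)(2^J-1)$, respectively. BIBDs: a BIBD with parameters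 $(V,K,\Lambda,R,B)$ consists of a vertex set of size $V$ and a sequence of $B\geq1$ subsets (blocks), all of size $K\geq2$, such that any two distinct vertices are contained together in exactly $\Lambda$ blocks (and then every vertex lies in exactly $R$ blocks). A set of subsets forms a BIBD if an enumeration of it without repetition is the block sequence of a BIBD. The incidence matrix of a BIBD is the $\{0,1\}$-matrix with rows indexed by blocks and columns by vertices, having a $1$ exactly when the vertex lies in the block. *)

(* Defs.v *)
From HB Require Import structures.
From mathcomp Require Import all_boot all_order all_algebra all_field.
From mathcomp Require Import sesquilinear mxtens.
From mathcomp Require Import boolp reals normedtype exp.
Set Implicit Arguments.
Unset Strict Implicit.
Unset Printing Implicit Defensive.
Import Order.TTheory GRing.Theory Num.Theory.
Import numFieldNormedType.Exports.
Local Open Scope ring_scope.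

Section FiniteFrames.
Variable R : realType.

(* The inner product of [H] induces its norm, so that [H] is a real Hilbert
   space; completeness is part of [completeNormedModType]. *)
Definition hilbert_inner (H : completeNormedModType R)
    (ip : {dot H for idfun}) : Prop :=
  forall x : H, `|x| ^+ 2 = ip x x.

(* The inner product of the Hilbert space $\mathbb{R}^I$ with [I] finite. *)
Section Dotp.
Variable I : finType.
Definition dotp (x y : {ffun I -> R^o}) : R := \sum_i x i * y i.

Lemma dotp_bilinear :
  bilinear_for (GRing.Scale.Law.clone _ _ ( *%R) _)
    (GRing.Scale.Law.clone _ _ (idfun \; *%R) _) dotp.
Proof.
split=> u a x y /=; rewrite /dotp mulr_sumr -big_split /=.
  by apply: eq_bigr => i _; rewrite !ffunE mulrDl -mulrA.
by apply: eq_bigr => i _; rewrite !ffunE mulrDr mulrCA.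
Qed.

Lemma dotp_sym x y : dotp x y = (-1) ^+ false * idfun (dotp y x).
Proof. by rewrite mul1r; apply: eq_bigr => i _; rewrite mulrC. Qed.

Lemma dotp_gt0 x : x != 0 -> 0 < dotp x x.
Proof.
move=> x0; rewrite lt_neqAle sumr_ge0 ?andbT; last first.
  by move=> i _; rewrite -expr2 sqr_ge0.
apply: contra x0 => /eqP/esym/eqP.
rewrite psumr_eq0 => [|i _]; last by rewrite -expr2 sqr_ge0.
move=> /allP x0; apply/eqP/ffunP => i; apply/eqP.
by have := x0 i; rewrite mem_index_enum mulf_eq0 orbb ffunE; apply.
Qed.

HB.instance Definition _ := @bilinear_isBilinear.Build R _ _ R _ _
  dotp dotp_bilinear.
HB.instance Definition _ := @isHermitianSesquilinear.Build R _ false idfun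
  dotp dotp_sym.
HB.instance Definition _ := @isDotProduct.Build R _ dotp dotp_gt0.
End Dotp.

(* A finite sequence $(\varphi_n)_{n\in K}$ is a pair of [phi : I -> U] and
   [K : {set I}]: the values of [phi] outside [K] are irrelevant. *)
Variables (I : finType) (U : lmodType R).

Definition in_span (phi : I -> U) (K : {set I}) (y : U) : Prop :=
  exists c : I -> R, y = \sum_(n in K) c n *: phi n.

(* [U] may be infinite-dimensional, hence an explicit basis of the span. *)
Definition span_has_dim (phi : I -> U) (K : {set I}) (d : nat) : Prop :=
  exists b : 'I_d -> U,
    (forall c : 'I_d -> R, \sum_i c i *: b i = 0 -> forall i, c i = 0) /\
    (forall y, in_span phi K y <-> exists c : 'I_d -> R, y = \sum_i c i *: b i).

Variable ip : {dot U for idfun}.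

Definition etf (phi : I -> U) (K : {set I}) : Prop :=
  [/\ K != set0,
      exists2 S : R, 0 < S & {in K, forall n, ip (phi n) (phi n) = S},
      exists2 C : R, 0 < C &
        {in K &, forall n1 n2, n1 != n2 -> `|ip (phi n1) (phi n2)| ^+ 2 = C} &
      exists2 A : R, 0 < A &
        forall y, in_span phi K y ->
          \sum_(n in K) ip (phi n) y *: phi n = A *: y].

Definition regular_simplex (phi : I -> U) (K : {set I}) : Prop :=
  etf phi K /\ span_has_dim phi K #|K|.-1.

Definition binder (phi : I -> U) (N : {set I}) : {set {set I}} :=
  [set K : {set I} | (K \subset N) && `[< regular_simplex phi K >]].

End FiniteFrames.

Section BIBD.
Variable T : finType.
Implicit Types (X : {set T}) (bs : seq {set T}) (P : {set {set T}}).

Definition is_bibd X (v k l r b : nat) bs : Prop :=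
  [/\ #|X| = v,
      size bs = b /\ (1 <= b)%N,
      (2 <= k)%N /\ {in bs, forall M : {set T}, M \subset X /\ #|M| = k},
      {in X &, forall x y, x != y ->
        count (fun M : {set T} => (x \in M) && (y \in M)) bs = l} &
      {in X, forall x, count (fun M : {set T} => x \in M) bs = r}].

Definition forms_bibd X P (v k l r b : nat) : Prop :=
  is_bibd X v k l r b (enum P).

End BIBD.

Definition enumerates (T : finType) (P : {set T}) (n : nat) (u : 'I_n -> T) :=
  injective u /\ [set u i | i : 'I_n] = P.

Definition incidence (R : nzRingType) (T : finType) (m n : nat)
    (block : 'I_m -> {set T}) (vertex : 'I_n -> T) : 'M[R]_(m, n) :=
  \matrix_(i, j) (vertex j \in block i)%:R.

Definition concat (T : Type) (m n : nat) (u : 'I_m -> T) (w : 'I_n -> T)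
    (i : 'I_(m + n)) : T :=
  match split i with inl j => u j | inr k => w k end.

(* Blocks with the same intersection with [X] are consecutive, and those with
   a nonempty intersection come first. *)
Definition arranged_by (T : finType) (X : {set T}) (n : nat)
    (block : 'I_n -> {set T}) : Prop :=
  (forall i j : 'I_n, (i <= j)%N ->
     block j :&: X != set0 -> block i :&: X != set0) /\
  (forall i j k : 'I_n, (i <= j <= k)%N ->
     block i :&: X = block k :&: X -> block j :&: X = block i :&: X).

Section Symplectic.
(* [finvect_type V] is [V] with its finite type structure. *)
Variable V : vectType 'F_2.
Local Notation W := (finvect_type V).
Variable B : {biscalar W}.

Definition symplectic : Prop :=
  (forall v, B v v = 0) /\ (forall v, (forall w, B v w = 0) -> v = 0).

Definition orthocomp (S : {set W}) : {set W} :=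
  [set w | [forall v in S, B v w == 0]].

Definition lagrangian (L : {set W}) : bool := orthocomp L == L.

Definition translate (v : W) (L : {set W}) : {set W} := [set v + x | x in L].

Definition affine_lagrangians : {set {set W}} :=
  [set translate vL.1 vL.2 | vL in [set: W * {set W}] & lagrangian vL.2].

Definition quadratic_form (Q : W -> 'F_2) : Prop :=
  forall v1 v2, B v1 v2 = Q (v1 + v2) + Q v1 + Q v2.

Definition quadric (Q : W -> 'F_2) : {set W} := [set v | Q v == 0].

Definition affine_quadric (D : {set W}) : Prop :=
  exists2 Q, quadratic_form Q & D = quadric Q \/ ~: D = quadric Q.

Variable R : realType.

(* $(-1)^{\mathrm{B}(v,w)}$, reading the elements of 'F_2 as 0 and 1 *)
Definition sgB (v w : W) : R := (-1) ^+ (B v w : nat).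

Definition psi (J : nat) (D : {set W}) (v2 : W) :
    {ffun {v : W | v \in ~: D} -> R^o} :=
  [ffun v1 => 2 `^ (- (J%:R - 1) / 2) * sgB (val v1) v2].

Definition hatphi_gram (J : nat) (D : {set W}) (H : lmodType R)
    (ip : {dot H for idfun}) (hatphi : W -> H) : Prop :=
  {in ~: D &, forall v1 v2, ip (hatphi v1) (hatphi v2) =
    if v1 == v2 then 2 ^+ J.-1 - 1 else - sgB v1 v2}.

End Symplectic.

(* Main.v *)
(* Write D as the zero set of q with B x y = q (x + y) + q x + q y + q 0.
   Character sums over a subspace S and its orthogonal complement turn #|D| into
   the number of points of D in any coset of an orthogonal complement. In
   particular an affine Lagrangian subspace that contains a point outside D meets
   D in exactly half of its points. Adjoining one vector at a time counts the
   Lagrangian subspaces L containing a given isotropic S, and likewise those with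
   v + L inside D, which yields all block parameters.

   If M is an affine Lagrangian subspace not inside D, then M :&: ~: D and M :&: D
   are cosets of isotropic subspaces of dimension J - 1. Exactly three affine
   Lagrangian subspaces extend each of them; for M :&: ~: D none of the three is
   inside D, for M :&: D exactly two are.

   All three frames have Gram matrix n * identity - eps with eps a b = +-1. A
   subsequence of such a frame is a regular simplex iff it has n vectors and
   eps a c = eps a b * eps b c: the linear dependencies of a simplex form a line,
   so A * identity - Gram has rank one. For the frames at hand the multiplicativity
   of eps reads B (a + b) (b + c) = 0, i.e. the differences span an isotropic
   subspace. *)
Require Import Defs.
From HB Require Import structures.
From mathcomp Require Import all_boot all_order all_algebra all_field.
From mathcomp Require Import sesquilinear mxtens.
From mathcomp Require Import boolp reals normedtype exp.
From mathcomp Require Import ring zify.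
Import Order.TTheory GRing.Theory Num.Theory.
Import numFieldNormedType.Exports.
Set Implicit Arguments.
Unset Strict Implicit.
Unset Printing Implicit Defensive.
Local Open Scope ring_scope.

(** * Counting by fibres, and ordering rows by fibres *)

Lemma card_imset_fibres (aT rT : finType) (f : aT -> rT) (A : {set aT}) c :
  {in A, forall x, #|[set y in A | f y == f x]| = c} ->
  #|A| = (#|f @: A| * c)%N.
Proof.
move=> fc; rewrite -sum1_card (partition_big_imset f) /= -sum_nat_const.
apply: eq_bigr => _ /imsetP[x xA ->]; rewrite -[RHS](fc x xA) -sum1dep_card.
by apply: eq_bigl => y.
Qed.

Section Intervals.
Variable n : nat.
Implicit Types A : {set 'I_n}.

Lemma card_ord_lt b : (b <= n)%N -> #|[set i : 'I_n | (i < b)%N]| = b.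
Proof.
move=> bn; rewrite -sum1dep_card -(big_ord_widen n (fun=> 1%N) bn).
by rewrite sum_nat_const card_ord muln1.
Qed.

Lemma card_ord_interval a b : (a <= b <= n)%N ->
  #|[set i : 'I_n | (a <= i < b)%N]| = (b - a)%N.
Proof.
move=> /andP[ab bn].
transitivity #|[set i : 'I_n | (i < b)%N] :\: [set i : 'I_n | (i < a)%N]|.
  by apply: eq_card => i; rewrite !inE -leqNgt.
rewrite cardsDS ?card_ord_lt // ?(leq_trans ab) //.
by apply/subsetP => i; rewrite !inE => /leq_trans->.
Qed.

(** A member [i] brings the [i + 1] indices up to [i] into [A], while a non-member confines [A] to
    the [i] indices below it; cardinalities decide both directions. *)
Lemma initial_segmentE A :
  (forall i j : 'I_n, (i <= j)%N -> j \in A -> i \in A) ->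
  forall i, (i \in A) = (i < #|A|)%N.
Proof.
move=> Adown i; apply/idP/idP => [iA|]; last apply: contraTT => iA.
  rewrite -[X in (X <= _)%N](card_ord_lt (ltn_ord i)); apply/subset_leq_card.
  by apply/subsetP => j; rewrite inE ltnS => /Adown; apply.
rewrite -leqNgt -(card_ord_lt (ltnW (ltn_ord i))); apply/subset_leq_card.
apply/subsetP => j jA; rewrite inE ltnNge; apply: contra iA => ij.
exact: Adown jA.
Qed.

(* The least index of a fibre is preceded by whole fibres, hence divisible by [c]. *)
Lemma fibre_divn (T : finType) (c : nat) (f : 'I_n -> T) :
  (0 < c)%N ->
  (forall i j k : 'I_n, (i <= j <= k)%N -> f i = f k -> f j = f i) ->
  (forall i, #|[set j | f j == f i]| = c) ->
  forall i j : 'I_n, (i %/ c = j %/ c)%N -> f i = f j.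
Proof.
move=> c0 fconv fcard i j ij; set F := [set k | f k == f i].
have [a /eqP fa amin] : exists2 a : 'I_n, f a == f i &
    forall k : 'I_n, f k == f i -> (a <= k)%N.
  by case: (@arg_minnP _ i (fun k => f k == f i) val) => // a; exists a.
(* By convexity the whole interval from [a] to [k] lies in the fibre, so it has at most [c]
   elements. *)
have inF k : f k = f i -> (a <= k < a + c)%N.
  move=> fk; rewrite amin ?fk //= -ltnS -addSn -leq_subLR subSS -(fcard i) -/F.
  have ak : (a <= k)%N by apply: amin; rewrite fk.
  rewrite -(@card_ord_interval a k.+1) ?(leqW ak) ?ltn_ord //.
  apply/subset_leq_card/subsetP => l; rewrite !inE ltnS => /(fconv _ _ _) fl.
  by rewrite fl ?fa ?fk.
(* A gap at [k] would, by convexity, confine the fibre to the [k - a < c] indices from [a] to just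
   below [k]. *)
have Fin (k : 'I_n) : (a <= k < a + c)%N -> k \in F.
  move=> /andP[ak kac]; apply: contraLR kac => kF.
  suff : (#|F| <= k - a)%N by rewrite fcard; lia.
  rewrite -(@card_ord_interval a k) ?ak ?(ltnW (ltn_ord k)) //.
  apply/subset_leq_card/subsetP => l lF; rewrite inE amin /=; last by rewrite inE in lF.
  rewrite ltnNge; apply: contra kF => kl; rewrite inE -fa.
  apply/eqP/(fconv a k l); first by rewrite ak.
  by move: lF; rewrite inE fa => /eqP.
have /dvdnP[d ad] : (c %| a)%N.
  rewrite -(card_ord_lt (ltnW (ltn_ord a))).
  rewrite (@card_imset_fibres _ _ f _ c) ?dvdn_mull // => x; rewrite inE => xa.
  rewrite -(fcard x); apply: eq_card => y; rewrite !inE andb_idl // => /eqP fy.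
  rewrite ltnNge; apply/negP => ay.
  have := fconv x a y; rewrite (ltnW xa) ay fy => /(_ isT erefl) fax.
  by have := amin x; rewrite -fax fa eqxx leqNgt xa => /(_ isT).
have divF k : (a <= k < a + c)%N -> (k %/ c = d)%N.
  by rewrite ad -mulSnr => /andP[h1 h2]; apply/eqP; rewrite eqn_leq -ltnS
    ltn_divLR // leq_divRL // h1 h2.
have jF : (a <= j < a + c)%N.
  have := ij; rewrite (divF i (inF i erefl)) => dj.
  by rewrite ad -mulSnr -ltn_divLR // -leq_divRL // -dj ltnSn leqnn.
by have := Fin j jF; rewrite inE => /eqP->.
Qed.

End Intervals.

Lemma exists_arranged (T : finType) (X : {set T}) (P : {set {set T}}) n :
  n = #|P| -> exists row : 'I_n -> {set T}, enumerates P row /\ arranged_by X row.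
Proof.
move=> nP.
(* The value [#|{set T}|] exceeds every rank, so sorting by [key] puts the blocks that miss [X]
   last; equal keys mean equal intersections with [X]. *)
pose key (M : {set T}) : nat :=
  if M :&: X == set0 then #|{set T}| else enum_rank (M :&: X).
have keyE M N : key M = key N -> M :&: X = N :&: X.
  rewrite /key; case: eqP => [->|_]; case: eqP => [->|_] //.
  - by move=> h; have := ltn_ord (enum_rank (N :&: X)); rewrite -h ltnn.
  - by move=> h; have := ltn_ord (enum_rank (M :&: X)); rewrite h ltnn.
  - by move=> /val_inj/enum_rank_inj.
pose leT (M N : {set T}) := (key M <= key N)%N.
pose s := sort leT (enum P).
have ss : size s = n by rewrite size_sort -cardE nP.
have us : uniq s by rewrite sort_uniq enum_uniq.
have sorted_s : sorted leT s by apply: sort_sorted => M N; apply: leq_total.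
pose row (i : 'I_n) := nth set0 s i.
have row_key (i j : 'I_n) : (i <= j)%N -> (key (row i) <= key (row j))%N.
  have leT_tr : transitive leT by move=> ? ? ?; apply: leq_trans.
  apply: (sorted_leq_nth leT_tr (fun M => leqnn (key M)) set0 sorted_s); by rewrite inE ss.
exists row; split; split.
- by move=> i j /eqP; rewrite nth_uniq ?ss // => /eqP/val_inj.
- apply/setP => M; rewrite -[RHS]mem_enum -[RHS](mem_sort leT); apply/imsetP/idP => [[i _ ->]|].
    by rewrite mem_nth ?ss.
  move=> Ms; have iM : (index M s < n)%N by rewrite -ss index_mem.
  by exists (Ordinal iM); rewrite // /row nth_index.
- move=> i j /row_key; rewrite /key; case: (boolP (row i :&: X == set0)) => // _.
  case: ifP => // _; rewrite leqNgt; by rewrite ltn_ord.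
- move=> i j k /andP[/row_key ij /row_key jk] ik; apply: keyE; apply/eqP.
  by rewrite eqn_leq ij andbT /key ik -/(key (row k)).
Qed.

(** * Regular simplices and Gram matrices *)

Section Simplex.
Variables (R : realType) (I : finType) (U : lmodType R) (ip : {dot U for idfun}).
Implicit Types (phi : I -> U) (K : {set I}).

Lemma dotZl a x y : ip (a *: x) y = a * ip x y.
Proof. exact: linearZl_LR. Qed.

Lemma dotC x y : ip x y = ip y x.
Proof. by rewrite hermC /= expr0 mul1r. Qed.

Lemma dot0l x : ip 0 x = 0.
Proof. exact: linear0l. Qed.

Lemma dot_sumZl (J : finType) (P : pred J) (c : J -> R) (f : J -> U) x :
  ip (\sum_(i | P i) c i *: f i) x = \sum_(i | P i) c i * ip (f i) x.
Proof. by rewrite linear_sumlz; apply: eq_bigr => i _; exact: dotZl. Qed.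

Lemma dot_eq0 x : ip x x = 0 -> x = 0.
Proof.
by move=> h; apply/eqP/negPn/negP => x0; have := @neq0_dnorm_gt0 _ _ _ ip x x0; rewrite h ltxx.
Qed.

(* The rows of [p] are linear dependencies, and these form a line. *)
Lemma dependency_rank1 phi K : K != set0 -> span_has_dim phi K #|K|.-1 ->
  forall p : I -> I -> R,
    {in K, forall a, \sum_(b in K) p a b *: phi b = 0} ->
    forall a b c d, a \in K -> b \in K -> c \in K -> d \in K ->
      p a b * p c d = p a d * p c b.
Proof.
move=> K0; have mE : #|K| = (#|K|.-1).+1 by rewrite prednK // card_gt0.
case=> b [bfree bspan] p hp.
have [M phiE] : exists M : 'M[R]_(#|K|, #|K|.-1),
    forall i, phi (enum_val i) = \sum_j M i j *: b j.
  have /choice[c cE] : forall i : 'I_#|K|, exists c : 'I_#|K|.-1 -> R,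
      phi (enum_val i) = \sum_j c j *: b j.
    move=> i; apply/bspan; exists (fun n => (n == enum_val i)%:R).
    rewrite (bigD1 (enum_val i)) ?enum_valP //= eqxx scale1r big1 ?addr0 // => n.
    by case/andP=> _ /negPf->; rewrite scale0r.
  exists (\matrix_(i, j) c i j) => i; rewrite cE.
  by apply: eq_bigr => j _; rewrite mxE.
have [N bE] : exists N : 'M[R]_(#|K|.-1, #|K|),
    forall j, b j = \sum_i N j i *: phi (enum_val i).
  have /choice[c cE] : forall j, exists c : I -> R, b j = \sum_(n in K) c n *: phi n.
    move=> j; apply/bspan; exists (fun i => (i == j)%:R).
    rewrite (bigD1 j) //= eqxx scale1r big1 ?addr0 // => i.
    by move=> /negPf->; rewrite scale0r.
  exists (\matrix_(j, i) c j (enum_val i)) => j; rewrite cE big_enum_val.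
  by apply: eq_bigr => i _; rewrite mxE.
have combE k (A : 'M[R]_(k, #|K|)) i :
    \sum_l A i l *: phi (enum_val l) = \sum_j (A *m M) i j *: b j.
  under eq_bigr => l _ do rewrite phiE scaler_sumr.
  rewrite exchange_big /=; apply: eq_bigr => j _.
  by rewrite mxE scaler_suml; apply: eq_bigr => l _; rewrite scalerA.
(* Freeness of [b] gives the coordinate matrix [M] a left inverse. So [M] has rank [#|K|.-1], and
   its left kernel, which contains every dependency, has dimension at most one. *)
have NM : N *m M = 1%:M.
  apply/matrixP => i j; apply/eqP; rewrite -subr_eq0; apply/eqP.
  move: j; apply: bfree; under eq_bigr => j _ do rewrite scalerBl.
  rewrite sumrB -combE -bE (bigD1 i) //= !mxE eqxx scale1r big1 ?addr0 ?subrr //.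
  by move=> j; rewrite mxE eq_sym => /negPf->; rewrite scale0r.
have rM : (#|K|.-1 <= \rank M)%N.
  by rewrite -{1}(mxrank1 R #|K|.-1) -NM mxrankM_maxr.
pose P := \matrix_(i < #|K|, j < #|K|) p (enum_val i) (enum_val j).
have PM : P *m M = 0.
  apply/matrixP => i j; rewrite [RHS]mxE; move: j; apply: bfree; rewrite -combE.
  rewrite -[RHS](hp (enum_val i)) ?enum_valP // [RHS]big_enum_val.
  by apply: eq_bigr => l _; rewrite mxE.
have rP : (\rank P <= 1)%N.
  have /mxrankS : (P <= kermx M)%MS by apply/sub_kermxP.
  by rewrite mxrank_ker; lia.
move=> a1 a2 a3 a4 h1 h2 h3 h4.
have pE x y (hx : x \in K) (hy : y \in K) :
    p x y = P (enum_rank_in hx x) (enum_rank_in hy y).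
  by rewrite mxE !enum_rankK_in.
(* As [P] has rank at most one, each entry is zero or a column factor times a row factor, and the
   identity becomes commutativity. *)
rewrite (pE _ _ h1 h2) (pE _ _ h3 h4) (pE _ _ h1 h4) (pE _ _ h3 h2) -(mulmx_base P).
move: (col_base P) (row_base P); case: (\rank P) rP => [|[|//]] _ C' R'.
  by rewrite !mxE !big_ord0 !mul0r.
by rewrite !mxE !big_ord_recl !big_ord0; ring.
Qed.

Section Characterization.
Variables (phi : I -> U) (K : {set I}) (n : nat) (eps : I -> I -> R).
Hypothesis n2 : (2 <= n)%N.
Hypothesis gram : {in K &, forall a b,
  ip (phi a) (phi b) = n%:R * (a == b)%:R - eps a b}.
Hypothesis eps_sqr : {in K &, forall a b, eps a b ^+ 2 = 1}.
Hypothesis eps_diag : {in K, forall a, eps a a = 1}.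

Let n1 : 1 < n%:R :> R. Proof. by rewrite ltr1n. Qed.

Lemma gram_diag a : a \in K -> ip (phi a) (phi a) = n%:R - 1.
Proof. by move=> aK; rewrite gram // eqxx mulr1 eps_diag. Qed.

Lemma gram_neq a b : a \in K -> b \in K -> a != b ->
  ip (phi a) (phi b) = - eps a b.
Proof. by move=> aK bK /negPf ab; rewrite gram // ab mulr0 add0r. Qed.

Lemma eps_sym : {in K &, forall a b, eps a b = eps b a}.
Proof.
move=> a b aK bK; have [->//|ab] := eqVneq a b.
by apply: oppr_inj; rewrite -!gram_neq // 1?dotC // eq_sym.
Qed.

Lemma regular_simplex_eps : regular_simplex ip phi K ->
  #|K| = n /\ {in K & &, forall a b c, eps a c = eps a b * eps b c}.
Proof.
case=> -[K0 _ _ [A A0 tight]] sdim.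
(* Tightness applied to [phi a] makes row [a] of [p] a dependency. Off the diagonal [p] is [eps];
   what remains is to show that its constant diagonal is 1. *)
pose p a b := A * (a == b)%:R - ip (phi b) (phi a).
have p_dep : {in K, forall a, \sum_(b in K) p a b *: phi b = 0}.
  move=> a aK; under eq_bigr => b _ do rewrite scalerBl.
  rewrite sumrB tight; last first.
    exists (fun b => (b == a)%:R); rewrite (bigD1 a) //= eqxx scale1r big1 ?addr0 //.
    by move=> b /andP[_ /negPf->]; rewrite scale0r.
  rewrite (bigD1 a) //= eqxx mulr1 big1 ?addr0 ?subrr // => b /andP[_].
  by rewrite eq_sym => /negPf->; rewrite mulr0 scale0r.
have rank1 := dependency_rank1 K0 sdim p_dep.
have p_diag a : a \in K -> p a a = A - (n%:R - 1).
  by move=> aK; rewrite /p eqxx mulr1 gram_diag.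
have p_neq a b : a \in K -> b \in K -> a != b -> p a b = eps a b.
  move=> aK bK ab; rewrite /p (negPf ab) mulr0 sub0r gram_neq 1?eq_sym //.
  by rewrite opprK eps_sym.
have [a aK] := set0Pn _ K0.
(* [\sum_b p a b *: phi b = 0] paired with [phi a]. *)
have trace : p a a * (n%:R - 1) = #|K|.-1%:R.
  have := congr1 (ip ^~ (phi a)) (p_dep a aK).
  rewrite /= dot0l dot_sumZl (bigD1 a) //= gram_diag // (eq_bigr (fun=> -1)).
    rewrite sumrN sumr_const => /eqP; rewrite subr_eq0 => /eqP->.
    rewrite (cardD1 a K) aK /=; congr _%:R; apply: eq_card => b.
    by rewrite !inE andbC.
  move=> b /andP[bK ba]; rewrite gram_neq // p_neq 1?eq_sym //.
  by rewrite eps_sym // mulrN -expr2 eps_sqr.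
have paa0 : 0 <= p a a.
  have n0 : 0 < n%:R - 1 :> R by rewrite subr_gt0.
  by rewrite -(pmulr_lge0 _ n0) trace ler0n.
(* Were [a] alone in [K], the span would have dimension 0, whereas [phi a] has squared norm
   [n - 1 > 0]. *)
have [b bK ba] : exists2 b, b \in K & b != a.
  apply/exists_inP; rewrite -negb_forall_in; apply/negP => /forall_inP Ka.
  have KE : K = [set a].
    by apply/setP => b; rewrite inE; apply/idP/eqP => [/Ka/eqP|->].
  move: sdim; rewrite KE cards1 /= => -[b' [_ /(_ (phi a))[+ _]]]; case.
    by exists (fun=> 1); rewrite big_set1 scale1r.
  move=> c; rewrite big_ord0 => phia; have := gram_diag aK.
  by rewrite phia dot0l => /eqP; rewrite eq_sym subr_eq0 (gt_eqF n1).
(* The minor on [a] and [b] gives [p a a ^+ 2 = 1], and [paa0] rules out [-1]. Then [trace] yields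
   the size of [K]. *)
have dd : p a a = 1.
  have := rank1 a a b b aK aK bK bK.
  rewrite (p_neq a b) 1?eq_sym // (p_neq b a) // eps_sym // -expr2 eps_sqr //.
  rewrite (p_diag b) // -(p_diag a) // -expr2 => /eqP.
  rewrite sqrf_eq1 => /orP[/eqP//|/eqP paa]; move: paa0.
  by rewrite paa oppr_ge0 ler10.
have pE : {in K &, forall x y, p x y = eps x y}.
  move=> x y xK yK; have [<-|xy] := eqVneq x y; last exact: p_neq.
  by rewrite eps_diag // p_diag // -(p_diag a).
split.
  apply/eqP; rewrite -(eqr_nat R); move: trace; rewrite dd mul1r => /eqP.
  have -> : #|K| = #|K|.-1.+1 by rewrite prednK // card_gt0.
  by rewrite subr_eq -natr1 eq_sym.
move=> x y z xK yK zK; have := rank1 x y y z xK yK yK zK.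
by rewrite !pE // eps_diag // mulr1.
Qed.

(** Multiplicativity gives [eps a b = z a * z b], so the Gram matrix is [n] times the orthogonal
    projection onto the complement of the sign vector [z]. Hence the frame is tight with constant
    [n], and [z] spans the dependencies. *)
Lemma eps_regular_simplex : #|K| = n ->
  {in K & &, forall a b c, eps a c = eps a b * eps b c} ->
  regular_simplex ip phi K.
Proof.
move=> cK epsM; have K0 : K != set0 by rewrite -card_gt0 cK; lia.
have [o oK] := set0Pn _ K0; pose z := eps o.
have epsE : {in K &, forall a b, eps a b = z a * z b}.
  by move=> a b aK bK; rewrite (epsM a o b) // eps_sym.
have zz a : a \in K -> z a * z a = 1 by move=> aK; rewrite -expr2 eps_sqr.
have gramE : {in K &, forall a b, ip (phi a) (phi b) = n%:R * (a == b)%:R - z a * z b}.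
  by move=> a b aK bK; rewrite gram // epsE.
have dep0 (c : I -> R) b : b \in K ->
    ip (\sum_(a in K) c a *: phi a) (phi b) =
    n%:R * c b - (\sum_(a in K) c a * z a) * z b.
  move=> bK; rewrite dot_sumZl (eq_bigr (fun a => n%:R * c a * (a == b)%:R
    - c a * z a * z b)); last by move=> a aK; rewrite gramE //; ring.
  rewrite sumrB -mulr_suml; congr (_ - _).
  rewrite (bigD1 b) //= eqxx mulr1 big1 ?addr0 // => a /andP[_ /negPf->].
  by rewrite mulr0.
have sumz : \sum_(a in K) z a *: phi a = 0.
  apply: dot_eq0; rewrite dot_sumZl big1 // => b bK; rewrite dotC dep0 //.
  by rewrite (eq_bigr (fun=> 1)) // sumr_const cK subrr mulr0.
have n0 : 0 < n%:R :> R by rewrite (lt_trans ltr01).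
split; first split=> //.
- by exists (n%:R - 1); [rewrite subr_gt0|move=> a; apply: gram_diag].
- exists 1 => // a b aK bK ab.
  by rewrite gram_neq // normrN real_normK ?num_real ?eps_sqr.
- exists n%:R => // y [c ->].
  under eq_bigr => b bK do rewrite dotC dep0 // scalerBl.
  rewrite sumrB.
  under [X in _ - X]eq_bigr => b bK do rewrite -scalerA.
  rewrite -scaler_sumr sumz scaler0 subr0 scaler_sumr.
  by apply: eq_bigr => b _; rewrite scalerA.
have cK' : #|K :\ o| = #|K|.-1 by rewrite (cardsD1 o K) oK.
have zo : z o = 1 by apply: eps_diag.
have sumE (d : I -> R) : d o = 0 ->
    \sum_(i < #|K :\ o|) d (enum_val i) *: phi (enum_val i) =
    \sum_(a in K) d a *: phi a.
  move=> d0; rewrite [RHS](bigD1 o) //= d0 scale0r add0r.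
  rewrite -(big_enum_val (A := mem (K :\ o)) (fun a => d a *: phi a)).
  by apply: eq_bigl => a; rewrite !inE andbC.
have dE (c : 'I_#|K :\ o| -> R) : exists d : I -> R,
    d o = 0 /\ forall i, d (enum_val i) = c i.
  exists (fun a => if [pick i | enum_val i == a] is Some i then c i else 0).
  split=> [|i].
    case: pickP => // i /eqP io.
    by have := enum_valP i; rewrite io !inE eqxx.
  by case: pickP => [j /eqP/enum_val_inj->//|/(_ i)]; rewrite eqxx.
(* As [z o = 1], the dependency [sumz] expresses [phi o] through the other vectors, which therefore
   form a basis. *)
rewrite -cK'; exists (fun i => phi (enum_val i)); split.
  move=> c; have [d [d0 dc]] := dE c; under eq_bigr do rewrite -dc.
  rewrite sumE // => sumd i; rewrite -dc.
  have dz b : b \in K -> n%:R * d b = (\sum_(a in K) d a * z a) * z b.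
    by move=> bK; apply/eqP; rewrite -subr_eq0 -dep0 // sumd dot0l.
  (* The coefficient at [o] is 0, so the common sum in [dz] vanishes, and with it every
     coefficient. *)
  have := dz o oK; rewrite d0 mulr0 zo mulr1 => m0.
  have /setD1P[_ /dz] := enum_valP i; rewrite -m0 mul0r => /eqP.
  by rewrite mulf_eq0 (gt_eqF n0) => /eqP.
move=> y; split=> [[e ->]|[c ->]].
  exists (fun i => e (enum_val i) - e o * z (enum_val i)).
  rewrite (sumE (fun a => e a - e o * z a)) ?zo ?mulr1 ?subrr //.
  under [RHS]eq_bigr => a _ do rewrite scalerBl -scalerA.
  by rewrite sumrB -scaler_sumr sumz scaler0 subr0.
have [d [d0 dc]] := dE c; exists d; rewrite -sumE //.
by apply: eq_bigr => i _; rewrite dc.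
Qed.

End Characterization.
End Simplex.

(** * Counting in block designs *)

Section BibdFamily.
Variable T : finType.
Implicit Types (X : {set T}) (P : {set {set T}}).

Lemma count_enum P (a : pred {set T}) : count a (enum P) = #|[set M in P | a M]|.
Proof. by rewrite -sum1_count big_enum_cond /= sum1dep_card. Qed.

(** Double counting of incident pairs gives [#|P| * k = v * r], so the number of blocks follows from
    the replication number. *)
Lemma forms_bibdI X P v k l r b :
  #|X| = v -> (2 <= k)%N -> (1 <= b)%N -> (v * r = b * k)%N ->
  {in P, forall M : {set T}, M \subset X /\ #|M| = k} ->
  {in X &, forall x y, x != y -> #|[set M in P | (x \in M) && (y \in M)]| = l} ->
  {in X, forall x, #|[set M in P | x \in M]| = r} ->
  forms_bibd X P v k l r b.
Proof.
move=> cX k2 b1 vr hP hl hr; split=> //.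
- split=> //; rewrite -cardE; apply/eqP.
  rewrite -(eqn_pmul2r (ltnW k2)) -vr -cX; apply/eqP.
  transitivity (\sum_(M in P) \sum_(x in M) 1)%N.
    by rewrite -sum_nat_const; apply: eq_bigr => M /hP[_ <-]; rewrite sum1_card.
  rewrite (exchange_big_dep (mem X)) /=; last first.
    by move=> M x /hP[/subsetP MX _] /MX.
  rewrite -sum_nat_const; apply: eq_bigr => x xX; rewrite -(hr x xX).
  by rewrite sum1dep_card; apply: eq_card => M; rewrite !inE.
- by split=> // M; rewrite mem_enum => /hP.
- by move=> x y xX yX xy; rewrite count_enum hl.
- by move=> x xX; rewrite count_enum hr.
Qed.

End BibdFamily.

(** A condition on the image selects whole fibres. This transfers counts of affine Lagrangian
    subspaces to counts of their components. *)
Lemma card_imset_fibres_cond (aT rT : finType) (f : aT -> rT) (A : {set aT}) c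
    (P : pred rT) :
  {in A, forall x, #|[set y in A | f y == f x]| = c} ->
  (#|[set y in f @: A | P y]| * c)%N = #|[set x in A | P (f x)]|.
Proof.
move=> fc; have -> : [set y in f @: A | P y] = f @: [set x in A | P (f x)].
  apply/setP => y; rewrite inE; apply/andP/imsetP => [[/imsetP[x xA ->] Px]|[x]].
    by exists x; rewrite // inE xA.
  by rewrite inE => /andP[xA Px] ->; split=> //; apply: imset_f.
apply/esym/card_imset_fibres => x; rewrite inE => /andP[xA Px].
rewrite -(fc x xA); apply: eq_card => y; rewrite !inE -andbA; congr (_ && _).
by rewrite andb_idl // => /eqP->.
Qed.
(** * Signs and characters over F_2 *)

Lemma F2P (a : 'F_2) : (a = 0) \/ (a = 1).
Proof.
by case: a => [[|[|//]] h]; [left|right]; apply: val_inj.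
Qed.

Lemma F2_neq1 (a : 'F_2) : (a != 1) = (a == 0).
Proof. by case: (F2P a) => ->. Qed.

Lemma F2_addbb (a : 'F_2) : a + a = 0.
Proof. by case: (F2P a) => ->; apply: val_inj. Qed.

Definition sg (R : pzRingType) (a : 'F_2) : R := (-1) ^+ (a : nat).

Section Sign.
Variable R : numDomainType.

Lemma sg0 : sg R 0 = 1. Proof. by []. Qed.

Lemma sg1 : sg R 1 = -1. Proof. by []. Qed.

Lemma sgD a b : sg R (a + b) = sg R a * sg R b.
Proof.
by case: (F2P a) => ->; case: (F2P b) => ->;
  rewrite ?F2_addbb ?addr0 ?add0r ?sg0 ?sg1 ?mulr1 ?mul1r ?mulrNN ?mulr1.
Qed.

Lemma sg_mul a : sg R a * sg R a = 1.
Proof. by rewrite -sgD F2_addbb. Qed.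

Lemma sg_inj : injective (sg R).
Proof.
have n1 : (1 : R) != -1 by rewrite -subr_eq0 opprK -mulr2n pnatr_eq0.
move=> a b; case: (F2P a) => ->; case: (F2P b) => -> //; rewrite sg0 sg1 => /eqP.
  by rewrite (negPf n1).
by rewrite eq_sym (negPf n1).
Qed.

Lemma sum_sg_card (T : finType) (A : {set T}) (f : T -> 'F_2) :
  \sum_(x in A) sg R (f x) =
    #|[set x in A | f x == 0]|%:R - #|[set x in A | f x == 1]|%:R.
Proof.
rewrite (bigID (fun x => f x == 0)) /=; congr (_ + _).
  rewrite -sum1_card natr_sum; apply: eq_big => [x|x /andP[_ /eqP->]] //.
  by rewrite inE.
rewrite -sum1_card natr_sum -sumrN; apply: eq_big => [x|x /andP[_]].
  by rewrite inE; case: (F2P (f x)) => ->.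
by case: (F2P (f x)) => -> // _; rewrite sg1.
Qed.

End Sign.

(** * Subspaces over the two-element field, their translates, and flag counting *)

Section Space.
Variable V : vectType 'F_2.
Local Notation W := (finvect_type V).

Lemma vaddvv (x : W) : x + x = 0.
Proof.
rewrite -[x]scale1r -scalerDl (_ : 1 + 1 = 0 :> 'F_2) ?scale0r //.
exact: val_inj.
Qed.

Lemma vaddKv (x y : W) : x + (x + y) = y.
Proof. by rewrite addrA vaddvv add0r. Qed.

Lemma vadd_eq0 (x y : W) : (x + y == 0) = (x == y).
Proof. by apply/eqP/eqP => [h|->]; rewrite ?vaddvv // -[y]add0r -h -addrA vaddvv addr0. Qed.

Lemma mem_translate (v y : W) L : (y \in translate v L) = (v + y \in L).
Proof.
apply/imsetP/idP => [[x xL ->]|h]; first by rewrite vaddKv.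
by exists (v + y); rewrite ?vaddKv.
Qed.

Lemma card_translate (v : W) L : #|translate v L| = #|L|.
Proof. by rewrite card_imset //; apply: addrI. Qed.

Definition subspace (S : {set W}) :=
  (0 \in S) && [forall x in S, forall y in S, x + y \in S].

Lemma subspaceP (S : {set W}) :
  reflect (0 \in S /\ {in S &, forall x y, x + y \in S}) (subspace S).
Proof.
apply: (iffP andP) => -[S0 SD]; split=> //.
  by move=> x y xS yS; move/forall_inP: SD => /(_ x xS)/forall_inP/(_ y yS).
by apply/forall_inP => x xS; apply/forall_inP => y yS; apply: SD.
Qed.

Lemma subspace_addl (S : {set W}) x y :
  subspace S -> x \in S -> (x + y \in S) = (y \in S).
Proof.
move=> /subspaceP[_ SD] xS; apply/idP/idP => [h|]; last exact: SD.
by rewrite -[y](vaddKv x) SD.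
Qed.

Lemma translate_id (S : {set W}) v w : subspace S -> w \in translate v S ->
  translate v S = translate w S.
Proof.
move=> sS; rewrite mem_translate => h; apply/setP => y; rewrite !mem_translate.
by rewrite -(subspace_addl (w + y) sS h) -addrA vaddKv.
Qed.

Lemma mem_translate_self (S : {set W}) v : subspace S -> v \in translate v S.
Proof. by case/subspaceP=> S0 _; rewrite mem_translate vaddvv. Qed.

Lemma translateK (v : W) L : translate v (translate v L) = L.
Proof. by apply/setP => y; rewrite !mem_translate vaddKv. Qed.

(** Over ['F_2] the span of a subspace [S] and [x] is the union of just these two cosets. *)
Definition adjoin (S : {set W}) x := S :|: translate x S.

Lemma subspace_adjoin (S : {set W}) x : subspace S -> subspace (adjoin S x).
Proof.
move=> sS; have /subspaceP[S0 SD] := sS; apply/subspaceP; split.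
  by rewrite inE S0.
move=> y z; rewrite !inE !mem_translate => /orP[]h /orP[]k.
- by rewrite (SD _ _ h k).
- by rewrite addrCA (SD _ _ h k) orbT.
- by rewrite addrA (SD _ _ h k) orbT.
- by rewrite -[y + z]add0r -(vaddvv x) addrACA (SD _ _ h k).
Qed.

Lemma card_adjoin (S : {set W}) x : subspace S -> x \notin S ->
  #|adjoin S x| = (2 * #|S|)%N.
Proof.
move=> sS xS; rewrite cardsU card_translate mul2n -addnn.
rewrite (_ : _ :&: _ = set0) ?cards0 ?subn0 //.
apply/setP => y; rewrite !inE mem_translate; apply/negP => /andP[yS].
by rewrite addrC subspace_addl // (negPf xS).
Qed.

Lemma sub_adjoin (S T : {set W}) x : subspace T -> S \subset T -> x \in T ->
  adjoin S x \subset T.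
Proof.
move=> sT ST xT; rewrite subUset ST; apply/subsetP => y; rewrite mem_translate.
by move=> /(subsetP ST); rewrite subspace_addl.
Qed.

(** Orthogonality of characters: translating by a point of [S] where [f] is 1 turns the sum into its
    negative. *)
Lemma sum_sg_linear (R : numDomainType) (S : {set W}) (f : W -> 'F_2) :
  subspace S -> {in S &, {morph f : x y / x + y}} ->
  \sum_(x in S) sg R (f x) = if [forall x in S, f x == 0] then #|S|%:R else 0.
Proof.
move=> sS fD; case: ifPn => [/forall_inP h|].
  rewrite -sum1_card natr_sum; apply: eq_bigr => x xS.
  by rewrite (eqP (h x xS)).
rewrite negb_forall_in => /exists_inP[a aS fa].
set T := \sum_(_ in _) _; suff: T = - T.
  by move/eqP; rewrite -subr_eq0 opprK -mulr2n mulrn_eq0 => /eqP.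
rewrite {1}/T (reindex_inj (addrI a)) /= (eq_bigl (mem S)); last first.
  by move=> x /=; rewrite subspace_addl.
rewrite -sumrN; apply: eq_bigr => x xS; rewrite fD // sgD.
by case: (F2P (f a)) fa => ->; rewrite ?eqxx // sg1 mulN1r.
Qed.

(* A greedy count of flags: ordering the elements adjoined to [S] until a good
   subspace of size [2 ^ J] is reached. *)
Lemma count_maximal (J : nat) (good : pred {set W}) (a : nat -> nat) :
  (forall S, good S -> subspace S) ->
  (forall S T : {set W}, subspace S -> S \subset T -> good T -> good S) ->
  (forall S k, (k < J)%N -> good S -> #|S| = (2 ^ k)%N ->
     #|[set x | (x \notin S) && good (adjoin S x)]| =
       ((2 ^ J - 2 ^ k) * a (J - k))%N) ->
  forall S k, (k <= J)%N -> good S -> #|S| = (2 ^ k)%N ->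
    #|[set T | [&& good T, #|T| == 2 ^ J & S \subset T]]|%N =
      (\prod_(1 <= j < (J - k).+1) a j)%N.
Proof.
move=> gsub gmono gcount S k kJ; move: {2}(J - k)%N (erefl (J - k)%N) => m.
elim: m S k kJ => [|m IH] S k kJ mE gS cS.
  have kE : k = J by lia.
  rewrite kE subnn big_nil; transitivity #|[set S]|; last by rewrite cards1.
  apply: eq_card => T.
  rewrite !inE; apply/and3P/eqP => [[_ /eqP cT ST]|->].
    by apply/esym/eqP; rewrite eqEcard ST cT cS kE /=.
  by rewrite gS cS kE eqxx subxx.
have kltJ : (k < J)%N by lia.
rewrite mE big_nat_recr //= -mE.
set F := [set T | _]; set X := [set x | (x \notin S) && good (adjoin S x)].
have pos : (0 < 2 ^ J - 2 ^ k)%N by rewrite subn_gt0 ltn_exp2l.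
apply/eqP; rewrite -(eqn_pmul2r pos); apply/eqP.
(* Pairs [(T, x)] with [x] in [T :\: S] are counted twice: each [T] admits [2 ^ J - 2 ^ k] points
   [x], and for each admissible [x] the induction hypothesis counts the [T] containing
   [adjoin S x]. *)
transitivity (\sum_(T in F) \sum_(x in T :\: S) 1)%N.
  rewrite -sum_nat_const; apply: eq_bigr => T.
  rewrite inE => /and3P[_ /eqP cT ST].
  by rewrite sum1_card cardsD (setIidPr ST) cT cS.
rewrite (exchange_big_dep (mem X)) /=; last first.
  move=> T x; rewrite !inE => /and3P[gT _ ST] /andP[xS xT].
  by rewrite xS (gmono _ T) ?subspace_adjoin ?gsub ?sub_adjoin ?gsub.
rewrite mulnAC -mulnA -(gcount S k) // mulnC -sum_nat_const.
apply: eq_bigr => x; rewrite inE => /andP[xS gSx].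
have := IH (adjoin S x) k.+1 kltJ _ gSx; rewrite card_adjoin ?gsub // cS -expnS.
move=> /(_ _ erefl) IHx.
rewrite sum1_card (_ : (J - k)%N = (J - k.+1).+1); last lia.
rewrite -IHx; last lia.
apply: eq_card => T; rewrite -topredE /= !inE -/(adjoin S x).
apply/andP/and3P => [[/and3P[gT cT ST] /andP[_ xT]]|[gT cT]].
  by rewrite gT cT sub_adjoin ?gsub.
by rewrite subUset => /andP[ST xST]; rewrite gT cT ST xS (subsetP xST) ?mem_translate_self ?gsub.
Qed.

(** * Isotropic and Lagrangian subspaces *)

Section Form.
Variable B : {biscalar W}.
Hypothesis hB : symplectic B.

Lemma BDl x y z : B (x + y) z = B x z + B y z.
Proof. exact: linearDl. Qed.

Lemma BDr x y z : B z (x + y) = B z x + B z y.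
Proof. exact: linearDr. Qed.

Lemma Bvv x : B x x = 0. Proof. by case: hB. Qed.

Lemma BC x y : B x y = B y x.
Proof.
have := Bvv (x + y); rewrite BDl !BDr !Bvv add0r addr0.
by case: (F2P (B x y)) => ->; case: (F2P (B y x)) => ->.
Qed.

Lemma B0r x : B x 0 = 0. Proof. exact: linear0r. Qed.

Lemma B0l x : B 0 x = 0. Proof. exact: linear0l. Qed.

Lemma orthocompP (S : {set W}) w :
  reflect {in S, forall v, B v w = 0} (w \in orthocomp B S).
Proof.
rewrite inE; apply: (iffP forall_inP) => h v vS; first exact/eqP/h.
by apply/eqP/h.
Qed.

Lemma subspace_orthocomp (S : {set W}) : subspace (orthocomp B S).
Proof.
apply/subspaceP; split=> [|x y /orthocompP hx /orthocompP hy].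
  by apply/orthocompP => v _; rewrite B0r.
by apply/orthocompP => v vS; rewrite BDr hx ?hy ?addr0.
Qed.

Lemma orthocompS (S T : {set W}) : S \subset T ->
  orthocomp B T \subset orthocomp B S.
Proof.
move=> ST; apply/subsetP => x /orthocompP h.
by apply/orthocompP => v /(subsetP ST)/h.
Qed.

Lemma orthocompK_sub (S : {set W}) : S \subset orthocomp B (orthocomp B S).
Proof.
apply/subsetP => x xS; apply/orthocompP => v /orthocompP h.
by rewrite BC h.
Qed.

Lemma sum_sgB (R : numDomainType) (S : {set W}) w : subspace S ->
  \sum_(x in S) sg R (B x w) = if w \in orthocomp B S then #|S|%:R else 0.
Proof.
move=> sS; rewrite inE; apply: sum_sg_linear => // x y _ _; exact: BDl.
Qed.

Lemma orthocompT : orthocomp B setT = [set 0].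
Proof.
apply/setP => x; apply/orthocompP/set1P => [h|-> v _].
  by case: hB => _; apply => w; rewrite BC h ?inE.
exact: B0r.
Qed.

(** Both sides evaluate the sum of the signs of [B x w] over [x] in [S] and all [w]. Summing over
    [x] first selects [w] in the complement; summing over [w] first leaves only [x = 0], by
    nondegeneracy. *)
Lemma card_orthocomp (S : {set W}) : subspace S ->
  (#|S| * #|orthocomp B S| = #|W|)%N.
Proof.
move=> sS; apply/eqP; rewrite -(eqr_nat int); apply/eqP.
transitivity (\sum_(w : W) \sum_(x in S) sg int (B x w)).
  under eq_bigr => w _ do rewrite sum_sgB //.
  rewrite -big_mkcond /= sumr_const mulnC natrM.
  by rewrite -[RHS]mulr_natl.
rewrite exchange_big /= (bigD1 0) /=; last by case/subspaceP: sS.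
rewrite [X in _ + X]big1 ?addr0 => [|x /andP[_ x0]].
  under eq_bigr => w _ do rewrite B0l.
  by rewrite sumr_const.
under eq_bigr => w _ do rewrite BC.
under eq_bigl => w do rewrite -(in_setT w).
rewrite sum_sgB; last by apply/subspaceP; split=> [|? ? _ _]; rewrite inE.
by rewrite orthocompT inE (negPf x0).
Qed.

Definition isotropic (S : {set W}) := subspace S && (S \subset orthocomp B S).

Lemma isotropicS (S T : {set W}) : subspace S -> S \subset T -> isotropic T ->
  isotropic S.
Proof.
move=> sS ST /andP[_ iT]; rewrite /isotropic sS (subset_trans ST) //.
exact/(subset_trans iT)/orthocompS.
Qed.

Lemma isotropic_adjoin (S : {set W}) x : isotropic S ->
  isotropic (adjoin S x) = (x \in orthocomp B S).
Proof.
move=> /andP[sS iS]; rewrite /isotropic subspace_adjoin //=.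
apply/idP/idP => [h|/orthocompP xS].
  have /(subsetP h) : x \in adjoin S x by rewrite inE mem_translate_self ?orbT.
  by apply/subsetP/orthocompS/subsetUl.
have ii (a b : W) : a \in S -> b \in S -> B a b = 0.
  by move=> aS /(subsetP iS)/orthocompP; apply.
apply/subsetP => y yS; apply/orthocompP => z zS; move: yS zS.
rewrite !inE !mem_translate => /orP[]h /orP[]k.
- exact: ii.
- by rewrite -[z](vaddKv x) BDl (ii _ _ k h) BC xS // addr0.
- by rewrite -[y](vaddKv x) BDr (ii _ _ k h) xS // addr0.
- rewrite -[z](vaddKv x) -[y](vaddKv x) BDl (BDr x _ x) (BDr x _ (x + z)).
  by rewrite Bvv (ii _ _ k h) BC xS // xS // !addr0.
Qed.

Section Count.
Variable J : nat.
Hypothesis cardW : #|W| = (2 ^ (2 * J))%N.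

Lemma lagrangianE (L : {set W}) :
  lagrangian B L = isotropic L && (#|L| == 2 ^ J)%N.
Proof.
apply/eqP/andP => [hL|[/andP[sL iL] /eqP cL]]; last first.
  apply/esym/eqP; rewrite eqEcard iL -(leq_pmul2l (_ : 0 < #|L|)%N) ?cL ?expn_gt0 //.
  by have := card_orthocomp sL; rewrite cL cardW -expnD addnn -mul2n => ->; rewrite leqnn.
have sL : subspace L by rewrite -hL subspace_orthocomp.
rewrite /isotropic sL hL subxx; split=> //.
have := card_orthocomp sL; rewrite hL cardW mulnn mulnC expnM => /eqP.
by rewrite eqn_exp2r.
Qed.

Lemma lagrangian_isotropic L : lagrangian B L -> isotropic L.
Proof. by rewrite lagrangianE => /andP[]. Qed.

Lemma lagrangian_subspace L : lagrangian B L -> subspace L.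
Proof. by move=> /lagrangian_isotropic/andP[]. Qed.

Lemma card_lagrangian L : lagrangian B L -> #|L| = (2 ^ J)%N.
Proof. by rewrite lagrangianE => /andP[_ /eqP]. Qed.

Lemma card_orthocomp_exp (S : {set W}) k : (k <= J)%N -> subspace S ->
  #|S| = (2 ^ k)%N -> #|orthocomp B S| = (2 ^ (2 * J - k))%N.
Proof.
move=> kJ sS cS; apply/eqP.
rewrite -(eqn_pmul2l (_ : 0 < 2 ^ k)%N) ?expn_gt0 // -{1}cS card_orthocomp //.
by rewrite cardW -expnD subnKC //; lia.
Qed.

(** The points that keep [T] isotropic form [orthocomp B T :\: T], and [2 ^ (2 * J - k) - 2 ^ k = (2
    ^ J - 2 ^ k) * (2 ^ (J - k) + 1)]. *)
Lemma count_lagrangian (S : {set W}) k : (k <= J)%N -> isotropic S ->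
  #|S| = (2 ^ k)%N ->
  #|[set L | lagrangian B L & S \subset L]| =
    (\prod_(1 <= j < (J - k).+1) (2 ^ j + 1))%N.
Proof.
move=> kJ iS cS; rewrite -(@count_maximal J isotropic (fun j => 2 ^ j + 1)%N _ _ _ S) //.
- by apply: eq_card => L; rewrite !inE lagrangianE andbA.
- by move=> T /andP[].
- by move=> T U; apply: isotropicS.
move=> {kJ iS cS} {k}T k kJ iT cT.
have /andP[sT TT] := iT.
transitivity #|orthocomp B T :\: T|.
  by apply: eq_card => x; rewrite !inE isotropic_adjoin // inE.
rewrite cardsD (setIidPr TT) cT (card_orthocomp_exp (ltnW kJ)) //.
rewrite mulnDr muln1 mulnBl -!expnD subnKC ?(ltnW kJ) //.
have le1 : (2 ^ k <= 2 ^ J)%N by rewrite leq_exp2l // ltnW.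
have le2 : (2 ^ J <= 2 ^ (J + (J - k)))%N by rewrite leq_exp2l // leq_addr.
by rewrite (_ : 2 * J - k = J + (J - k))%N; lia.
Qed.

(** * Affine quadrics *)

Section Quadric.
Variable q : W -> 'F_2.
Hypothesis hq : forall x y, B x y = q (x + y) + q x + q y + q 0.
Local Notation D := [set x | q x == 0].

Lemma quadD x y : q (x + y) = q x + q y + q 0 + B x y.
Proof.
by rewrite hq; case: (F2P (q (x + y))); case: (F2P (q x)); case: (F2P (q y));
  case: (F2P (q 0)) => -> -> -> ->; apply: val_inj.
Qed.

Hypothesis J0 : (0 < J)%N.
Hypothesis cardD : #|D| = (2 ^ J.-1 * (2 ^ J + 1))%N.

(** The sum is [#|D| - #|~: D|]; through it the size of [D] enters the coset counts. *)
Lemma sum_sgq (R : numDomainType) : \sum_x sg R (q x) = 2 ^+ J.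
Proof.
under eq_bigl => x do rewrite -(in_setT x).
rewrite sum_sg_card (_ : [set x in setT | q x == 0] = D); last first.
  by apply/setP => x; rewrite !inE.
rewrite (_ : [set x in setT | q x == 1] = ~: D); last first.
  by apply/setP => x; rewrite !inE -F2_neq1 negbK.
apply/eqP; rewrite subr_eq -natrX -natrD eqr_nat.
have := cardsC D; rewrite cardD cardW; case: J J0 => // j _ /=.
rewrite mul2n -addnn expnD expnS; lia.
Qed.

(** Completing the square: [q x + B z x] equals [q (z + x)] up to the constant [q z + q 0]. So the
    sign function of [q] is its own Fourier transform up to a scalar. *)
Lemma sum_sgq_char (R : numDomainType) z :
  \sum_x sg R (q x) * sg R (B z x) = 2 ^+ J * sg R (q z + q 0).
Proof.
rewrite -sum_sgq mulr_suml (reindex_inj (addrI z)) /=; apply: eq_bigr => x _.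
rewrite -!sgD; congr sg; rewrite BDr Bvv add0r quadD.
by case: (F2P (B z x)); case: (F2P (q x)); case: (F2P (q z));
  case: (F2P (q 0)) => -> -> -> ->; apply: val_inj.
Qed.

(* Poisson summation over the cosets of [S] and of its orthogonal complement. *)
Lemma sum_sgq_orthocomp (S : {set W}) v : subspace S ->
  #|S|%:R * (\sum_(x in orthocomp B S) sg int (q (v + x))) =
  2 ^+ J * sg int (q v) * (\sum_(x in S) sg int (q (v + x))).
Proof.
(* The inner character sum is [#|S|] times the indicator of [orthocomp B S]. *)
move=> sS; transitivity (\sum_(x : W) sg int (q (v + x)) *
    (\sum_(l in S) sg int (B l x))).
  rewrite mulr_sumr big_mkcond /=; apply: eq_bigr => x _.
  by rewrite sum_sgB //; case: ifP => _; rewrite ?mulr0 // mulrC.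
under eq_bigr => x _ do rewrite mulr_sumr.
rewrite exchange_big mulr_sumr /=; apply: eq_bigr => l lS.
rewrite (reindex_inj (addrI v)) /=.
under eq_bigr => x _ do rewrite vaddKv BDr sgD mulrCA.
rewrite -mulr_sumr sum_sgq_char mulrCA -!mulrA; congr (_ * _).
rewrite -!sgD; congr sg; rewrite quadD BC.
by case: (F2P (B v l)); case: (F2P (q l)); case: (F2P (q v));
  case: (F2P (q 0)) => -> -> -> ->; apply: val_inj.
Qed.

(** For [v = 0] and [q 0 = 0] these are the totally singular subspaces of the quadratic form [q]. *)
Definition singular v (S : {set W}) := isotropic S && (translate v S \subset D).

Lemma singularP v (S : {set W}) :
  reflect (isotropic S /\ {in S, forall x, q (v + x) = 0}) (singular v S).
Proof.
apply: (iffP andP) => -[iS h]; split=> //.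
  move=> x xS; have /(subsetP h) : v + x \in translate v S by rewrite mem_translate vaddKv.
  by rewrite inE => /eqP.
apply/subsetP => y; rewrite mem_translate => /h; rewrite vaddKv inE => ->.
by [].
Qed.

(** With [B x y = 0] on [S], the map [x |-> q (v + x) + q v] is additive on [S], so the part of
    [v + S] on either side of [D] is governed by a linear functional. *)
Lemma quad_isotropic (S : {set W}) v x y : isotropic S -> x \in S -> y \in S ->
  q (v + (x + y)) + q v = (q (v + x) + q v) + (q (v + y) + q v).
Proof.
move=> /andP[_ iS] xS /(subsetP iS)/orthocompP/(_ _ xS).
rewrite !quadD BDr => ->.
by case: (F2P (B v x)); case: (F2P (B v y)); case: (F2P (q v)); case: (F2P (q x));
  case: (F2P (q y)); case: (F2P (q 0)) => -> -> -> -> -> ->; apply: val_inj.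
Qed.

Lemma singular_adjoin v (S : {set W}) x : singular v S ->
  singular v (adjoin S x) = (x \in orthocomp B S) && (q (v + x) == 0).
Proof.
move=> /singularP[iS hS]; have /andP[sS _] := iS.
have S0 : 0 \in S by case/subspaceP: sS.
apply/singularP/andP; rewrite isotropic_adjoin //.
  move=> [-> h]; split=> //; apply/eqP/h.
  by rewrite inE mem_translate_self ?orbT.
move=> [xS /eqP qx]; split=> // y; rewrite !inE mem_translate => /orP[/hS//|yS].
have iA : isotropic (adjoin S x) by rewrite isotropic_adjoin.
rewrite -[y](vaddKv x); apply/eqP; rewrite -[_ == _]/(_ == 0 + 0).
have qv : q v = 0 by rewrite -[v]addr0 hS.
have := @quad_isotropic _ v x (x + y) iA.
rewrite qv !addr0 => ->; first by rewrite qx hS.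
  by rewrite inE mem_translate_self ?orbT.
by rewrite inE yS.
Qed.

(** By [sum_sgq_orthocomp] the signs over [v + orthocomp B T] sum to [2 ^ J], so half of
    [2 ^ (2 * J - k) + 2 ^ J] points lie in [D]. Removing the [2 ^ k] points of [T] leaves
    [(2 ^ J - 2 ^ k) * (2 ^ (J - k).-1 + 1)] admissible ones; the lowered exponent shifts the
    product to start at 0. *)
Lemma count_lagrangian_singular v (S : {set W}) k : (k <= J)%N ->
  singular v S -> #|S| = (2 ^ k)%N ->
  #|[set L | [&& lagrangian B L, S \subset L & translate v L \subset D]]| =
    (\prod_(0 <= j < J - k) (2 ^ j + 1))%N.
Proof.
move=> kJ iS cS; transitivity (\prod_(1 <= j < (J - k).+1) (2 ^ j.-1 + 1))%N;
  last by rewrite big_add1.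
rewrite -(@count_maximal J (singular v) (fun j => 2 ^ j.-1 + 1)%N _ _ _ S) //.
- apply: eq_card => L; rewrite !inE lagrangianE /singular.
  by case: (isotropic L); case: (_ == _); rewrite //= ?andbF // andbC.
- by move=> T /andP[/andP[]].
- move=> T U sT TU /singularP[iU h]; apply/singularP; split.
    exact: isotropicS iU.
  by move=> x /(subsetP TU)/h.
move=> {kJ iS cS} {k}T k kJ iT cT.
have /singularP[/andP[sT TT] qT] := iT.
set X := [set x in orthocomp B T | q (v + x) == 0].
have TX : T \subset X.
  by apply/subsetP => x xT; rewrite inE qT ?eqxx ?andbT //; apply: (subsetP TT).
transitivity #|X :\: T|.
  by apply: eq_card => x; rewrite !inE singular_adjoin // inE.
rewrite cardsD (setIidPr TX) cT.
have qv : q v = 0 by rewrite -[v]addr0 qT //; case/subspaceP: sT.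
set Y := [set x in orthocomp B T | q (v + x) == 1].
have cXY : (#|X| + #|Y| = 2 ^ (2 * J - k))%N.
  rewrite -(card_orthocomp_exp (ltnW kJ) sT cT).
  rewrite -[RHS](cardsID [set x | q (v + x) == 0]); congr (_ + _)%N.
    by apply: eq_card => x; rewrite !inE.
  by apply: eq_card => x; rewrite !inE andbC -F2_neq1; case: (F2P (q (v + x))) => ->.
have := sum_sgq_orthocomp v sT; rewrite qv mulr1.
rewrite [X in _ = _ * X](eq_bigr (fun=> 1)); last by move=> x xT; rewrite qT.
rewrite sumr_const mulrC => /mulIf; rewrite sum_sg_card -/X -/Y => /(_ _)/eqP.
rewrite cT pnatr_eq0 expn_eq0 /= => /(_ isT); rewrite subr_eq -natrX -natrD eqr_nat.
move=> /eqP; move: cXY; have [n nE] : exists n, (J - k = n.+1)%N.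
  by exists (J - k).-1; lia.
have JE : J = (k + n.+1)%N by rewrite -nE subnKC // ltnW.
have e1 : (2 * J - k = k + n.+1 + n.+1)%N by rewrite JE; lia.
rewrite nE e1 JE.
rewrite /= mulnBl !expnD !expnS; move: (2 ^ k)%N (2 ^ n)%N => a b.
lia.
Qed.

(** * Intersections of affine Lagrangian subspaces with [D] and its complement *)

(** As [L] is its own orthogonal complement, the summation formula equates the coset sum with its
    negative once [q v = 1]. *)
Lemma coset_sum0 L v : lagrangian B L -> q v = 1 ->
  \sum_(x in L) sg int (q (v + x)) = 0.
Proof.
move=> lL qv; have sL := lagrangian_subspace lL; have cL := card_lagrangian lL.
have := sum_sgq_orthocomp v sL; rewrite (eqP lL) qv sg1 cL mulrN1 natrX mulNr.
move/eqP; rewrite -subr_eq0 opprK -mulr2n mulrn_eq0 mulf_eq0 expf_eq0 /= andbF /=.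
by move/eqP.
Qed.

Lemma coset_balanced L v : lagrangian B L -> q v = 1 ->
  #|[set x in L | q (v + x) == 0]| = (2 ^ J.-1)%N /\
  #|[set x in L | q (v + x) == 1]| = (2 ^ J.-1)%N.
Proof.
move=> lL qv; have := coset_sum0 lL qv.
move/eqP; rewrite sum_sg_card subr_eq0 eqr_nat => /eqP.
set X := [set x in L | q (v + x) == 0]; set Y := [set x in L | q (v + x) == 1].
have : (#|X| + #|Y| = 2 ^ J)%N.
  rewrite -(card_lagrangian lL) -[RHS](cardsID [set x | q (v + x) == 0]).
  congr (_ + _)%N; first by apply: eq_card => x; rewrite !inE.
  by apply: eq_card => x; rewrite !inE andbC -F2_neq1; case: (F2P (q (v + x))) => ->.
by case: J J0 => // j _; rewrite expnS /=; lia.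
Qed.

Lemma affine_lagrangianP (M : {set W}) :
  reflect (exists v L, lagrangian B L /\ M = translate v L)
    (M \in affine_lagrangians B).
Proof.
apply: (iffP imsetP) => [[[v L]]|[v [L [lL ->]]]].
  by rewrite !inE /= => lL ->; exists v, L.
by exists (v, L); rewrite // !inE.
Qed.

Lemma affine_lagrangianE v (M : {set W}) : v \in M ->
  (M \in affine_lagrangians B) = lagrangian B (translate v M).
Proof.
move=> vM; apply/affine_lagrangianP/idP => [[w [L [lL ME]]]|lM].
  rewrite ME (@translate_id L w v) ?lagrangian_subspace ?translateK //.
  by rewrite -ME.
by exists v, (translate v M); rewrite translateK.
Qed.

Lemma mem_affine_lagrangian v L : lagrangian B L ->
  translate v L \in affine_lagrangians B.
Proof. by move=> lL; apply/affine_lagrangianP; exists v, L. Qed.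

Lemma card_affine_lagrangian (M : {set W}) : M \in affine_lagrangians B -> #|M| = (2 ^ J)%N.
Proof.
by case/affine_lagrangianP=> v [L [lL ->]]; rewrite card_translate card_lagrangian.
Qed.

(** Translation by [x] is an involution that matches blocks through [x] with Lagrangian subspaces,
    reducing block counts to linear ones. *)
Lemma count_affine_through x (P : pred {set W}) :
  #|[set M in affine_lagrangians B | (x \in M) && P M]| =
  #|[set L | lagrangian B L & P (translate x L)]|.
Proof.
rewrite -[LHS](card_imset _ (can_inj (translateK x))); apply: eq_card => L.
rewrite [RHS]inE; apply/imsetP/idP => [[M]|/andP[lL PL]].
  rewrite inE => /and3P[aM xM PM] ->.
  by rewrite -affine_lagrangianE // aM translateK.
exists (translate x L); rewrite ?translateK // inE mem_affine_lagrangian //.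
by rewrite mem_translate_self ?lagrangian_subspace.
Qed.

Lemma mem_affine_nsubset (M : {set W}) : M \in affine_lagrangians B -> ~~ (M \subset D) ->
  exists2 v, v \in M & q v = 1.
Proof.
move=> _ /subsetPn[v vM]; rewrite inE => qv; exists v => //.
by case: (F2P (q v)) qv => ->.
Qed.

Lemma card_component (M : {set W}) : M \in affine_lagrangians B -> ~~ (M \subset D) ->
  #|M :&: D| = (2 ^ J.-1)%N /\ #|M :&: ~: D| = (2 ^ J.-1)%N.
Proof.
move=> aM /(mem_affine_nsubset aM)[v vM qv].
move: (aM); rewrite (affine_lagrangianE vM) => lM.
have [c0 c1] := coset_balanced lM qv; split.
  rewrite -c0 -[LHS](card_translate v); apply: eq_card => x.
  by rewrite mem_translate !inE mem_translate.
rewrite -c1 -[LHS](card_translate v); apply: eq_card => x.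
by rewrite mem_translate !inE mem_translate -F2_neq1 negbK.
Qed.

(** For Lagrangian [L], the values 0 and 1 of [c] give the directions of the [D]- and
    [~: D]-components of [v + L]. *)
Lemma subspace_level L v c : isotropic L -> q v = c ->
  isotropic [set x in L | q (v + x) == c].
Proof.
move=> iL qv; apply: isotropicS (iL); last first.
  by apply/subsetP => x; rewrite inE => /andP[].
have /andP[/subspaceP[L0 LD] _] := iL; apply/subspaceP; split.
  by rewrite inE L0 addr0 qv eqxx.
move=> x y; rewrite !inE => /andP[xL /eqP qx] /andP[yL /eqP qy].
rewrite LD //=; have := quad_isotropic v iL xL yL.
by rewrite qx qy qv => /eqP; case: (F2P (q (v + (x + y)))) => ->; case: (F2P c) => ->.
Qed.

(** After translation by a point [v] off [D], the extensions are the Lagrangian subspaces containing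
    the direction [S] of the component. [S] has dimension [J - 1], so there are [2 ^ 1 + 1] of them.
    All pass through [v], hence none lies in [D]. *)
Lemma count_extensions (M0 : {set W}) : M0 \in affine_lagrangians B -> ~~ (M0 \subset D) ->
  #|[set M in affine_lagrangians B | ~~ (M \subset D) &
      M :&: ~: D == M0 :&: ~: D]| = 3%N.
Proof.
move=> aM0 nM0; have [v vM0 qv] := mem_affine_nsubset aM0 nM0.
have iL0 : isotropic (translate v M0).
  by apply/lagrangian_isotropic; rewrite -affine_lagrangianE.
have := subspace_level iL0 qv; set S := [set x in _ | _] => iS.
have cS : #|S| = (2 ^ J.-1)%N.
  by have [|_ ->] := @coset_balanced (translate v M0) v _ qv;
    rewrite -?affine_lagrangianE.
have := count_lagrangian (leq_pred J) iS cS.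
rewrite (_ : (J - J.-1).+1 = 2)%N; last by case: J J0 => // j _; lia.
rewrite big_nat1 => c3; rewrite -[RHS]c3 {c3}.
rewrite -[RHS](card_imset _ (can_inj (translateK v))); apply: eq_card => M.
rewrite !inE; apply/and3P/imsetP => [[aM nM /eqP MM]|[L]].
  have vM : v \in M.
    have : v \in M :&: ~: D by rewrite MM !inE vM0 qv.
    by rewrite inE => /andP[].
  exists (translate v M); rewrite ?translateK // inE -affine_lagrangianE // aM.
  apply/subsetP => x; rewrite inE !mem_translate => /andP[xM qx].
  have : v + x \in M0 :&: ~: D by rewrite !inE xM (eqP qx).
  by rewrite -MM inE => /andP[].
rewrite inE => /andP[lL SL] ->.
have aM := mem_affine_lagrangian v lL.
have nM : ~~ (translate v L \subset D).
  apply/subsetPn; exists v; last by rewrite inE qv.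
  by rewrite mem_translate_self ?lagrangian_subspace.
split=> //; rewrite eq_sym eqEcard; apply/andP; split; last first.
  by have [_ ->] := card_component aM nM; have [_ ->] := card_component aM0 nM0.
apply/subsetP => x; rewrite !inE -F2_neq1 negbK => /andP[xM qx].
rewrite qx andbT mem_translate; apply: (subsetP SL).
by rewrite inE mem_translate vaddKv xM.
Qed.

(* Of the three affine Lagrangian subspaces containing [M :&: D], two lie in [D]. *)
Lemma component_inj :
  {in [set M in affine_lagrangians B | ~~ (M \subset D)] &,
    injective (fun M => M :&: D)}.
Proof.
move=> M1 M2; rewrite !inE => /andP[a1 n1] /andP[a2 n2] MM.
have [c1 _] := card_component a1 n1.
have /set0Pn[v] : M1 :&: D != set0 by rewrite -card_gt0 c1 expn_gt0.
move=> vM1D; have : v \in M2 :&: D by rewrite -MM.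
move: vM1D; rewrite inE => /andP[vM1]; rewrite inE => /eqP qv.
rewrite inE => /andP[vM2 _].
move: (a1) (a2); rewrite (affine_lagrangianE vM1) (affine_lagrangianE vM2) => l1 l2.
have iL1 := lagrangian_isotropic l1.
have := subspace_level iL1 qv; set S := [set x in _ | _] => iS.
have SE x : (x \in S) = (v + x \in M1 :&: D) by rewrite !inE mem_translate.
have cS : #|S| = (2 ^ J.-1)%N.
  rewrite -c1 -[RHS](card_translate v); apply: eq_card => x.
  by rewrite SE mem_translate.
have sS : singular v S.
  by apply/singularP; split=> // x; rewrite inE => /andP[_ /eqP].
have := count_lagrangian (leq_pred J) iS cS.
have := count_lagrangian_singular (leq_pred J) sS cS.
rewrite (_ : J - J.-1 = 1)%N; last by case: J J0 => // j _; lia.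
rewrite !big_nat1 => cD cA.
set A := [set L | _] in cA; set A' := [set L | _] in cD.
(* Of the [2 ^ 1 + 1] Lagrangian subspaces over [S], [2 ^ 0 + 1] translate into [D]; [M1] and [M2]
   must share the one left. *)
have : #|A :\: A'| = 1%N.
  rewrite cardsD (setIidPr _) ?cA ?cD //.
  by apply/subsetP => L; rewrite !inE => /and3P[-> ->].
move=> /eqP/cards1P[L0 AE]; apply: (can_inj (translateK v)).
have memA M : lagrangian B (translate v M) -> ~~ (M \subset D) -> v \in M ->
    M :&: D = M1 :&: D -> translate v M = L0.
  move=> lM nM vM eM; apply/set1P; rewrite -AE !inE lM translateK (negPf nM) !andbF /=.
  apply/subsetP => x; rewrite SE -eM mem_translate inE.
  by case/andP.
by rewrite memA // memA.
Qed.

(** * The block designs on the whole space, on [D] and on its complement *)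

Local Notation AL := (affine_lagrangians B).
Local Notation line z := (adjoin [set 0] z).

Lemma isotropic0 : isotropic [set 0].
Proof.
rewrite /isotropic; apply/andP; split; last first.
  by rewrite sub1set; case/subspaceP: (subspace_orthocomp [set 0]).
apply/subspaceP; split=> [|x y /set1P-> /set1P->]; by rewrite ?addr0 inE.
Qed.

Lemma isotropic_line z : isotropic (line z).
Proof.
rewrite isotropic_adjoin ?isotropic0 //; apply/orthocompP => v /set1P->.
exact: B0l.
Qed.

Lemma card_line z : z != 0 -> #|line z| = (2 ^ 1)%N.
Proof.
have /andP[s0 _] := isotropic0.
by move=> z0; rewrite card_adjoin ?cards1 // inE.
Qed.

Lemma sub_line L z : subspace L -> (line z \subset L) = (z \in L).
Proof.
move=> sL; have /subspaceP[L0 _] := sL; apply/idP/idP => [/subsetP|zL].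
  by apply; have /andP[s0 _] := isotropic0; rewrite inE mem_translate_self ?orbT.
by apply: sub_adjoin => //; rewrite sub1set.
Qed.

Lemma singular0 x : x \in D -> singular x [set 0].
Proof.
rewrite inE => /eqP qx; apply/singularP; split; first exact: isotropic0.
by move=> y /set1P->; rewrite addr0.
Qed.

Lemma singular_line x y : x \in D -> y \in D -> singular x (line (x + y)).
Proof.
move=> xD; rewrite singular_adjoin ?singular0 // vaddKv inE => ->.
by rewrite andbT; apply/orthocompP => v /set1P->; apply: B0l.
Qed.

Lemma count_AL1 x : #|[set M in AL | x \in M]| =
  (\prod_(1 <= j < J.+1) (2 ^ j + 1))%N.
Proof.
have := count_lagrangian (leq0n J) isotropic0; rewrite cards1 => /(_ erefl).
rewrite subn0 => <-.
rewrite -[RHS](eq_card (A := [set L | lagrangian B L & predT (translate x L)])).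
  by rewrite -count_affine_through; apply: eq_card => M; rewrite !inE andbT.
move=> L; rewrite !inE; case: (boolP (lagrangian B L)) => //= lL.
by rewrite sub1set; have /subspaceP[-> _] := lagrangian_subspace lL.
Qed.

(** A block through [x] contains [y] exactly when its direction contains the line of [x + y], an
    isotropic subspace of dimension 1. *)
Lemma count_AL2 x y : x != y -> #|[set M in AL | (x \in M) && (y \in M)]| =
  (\prod_(1 <= j < J) (2 ^ j + 1))%N.
Proof.
move=> xy; have z0 : x + y != 0 by rewrite vadd_eq0.
have := count_lagrangian J0 (isotropic_line (x + y)) (card_line z0).
rewrite subn1 prednK // => <-; rewrite count_affine_through; apply: eq_card => L.
rewrite !inE; case: (boolP (lagrangian B L)) => //= lL.
by rewrite sub_line ?lagrangian_subspace // mem_translate.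
Qed.

Lemma count_ALD1 x : x \in D ->
  #|[set M in AL | (x \in M) && (M \subset D)]| = (\prod_(0 <= j < J) (2 ^ j + 1))%N.
Proof.
move=> xD; have := count_lagrangian_singular (leq0n J) (singular0 xD).
rewrite cards1 subn0 => /(_ erefl) <-; rewrite count_affine_through.
apply: eq_card => L; rewrite !inE; case: (boolP (lagrangian B L)) => //= lL.
by rewrite sub1set; have /subspaceP[-> _] := lagrangian_subspace lL.
Qed.

Lemma count_ALD2 x y : x \in D -> y \in D -> x != y ->
  #|[set M in AL | [&& x \in M, y \in M & M \subset D]]| =
  (\prod_(0 <= j < J.-1) (2 ^ j + 1))%N.
Proof.
move=> xD yD xy; have z0 : x + y != 0 by rewrite vadd_eq0.
have := count_lagrangian_singular J0 (singular_line xD yD) (card_line z0).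
rewrite subn1 => <-.
rewrite (count_affine_through x (fun M : {set W} => (y \in M) && (M \subset D))).
apply: eq_card => L; rewrite !inE; case: (boolP (lagrangian B L)) => //= lL.
by rewrite sub_line ?lagrangian_subspace // mem_translate.
Qed.

Lemma prod_gt0 m n : (0 < \prod_(m <= j < n) (2 ^ j + 1))%N.
Proof. by apply: prodn_gt0 => j; rewrite addn1. Qed.

Hypothesis J2 : (2 <= J)%N.

Lemma bibd_AL : forms_bibd [set: W] AL (2 ^ (2 * J)) (2 ^ J)
  (\prod_(1 <= j < J) (2 ^ j + 1)) (\prod_(1 <= j < J.+1) (2 ^ j + 1))
  (2 ^ J * \prod_(1 <= j < J.+1) (2 ^ j + 1)).
Proof.
apply: forms_bibdI.
- by rewrite cardsT cardW.
- by rewrite -{1}(expn1 2) leq_exp2l.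
- by rewrite muln_gt0 expn_gt0 prod_gt0.
- by rewrite mulnAC -expnD addnn -mul2n.
- by move=> M aM; rewrite subsetT card_affine_lagrangian.
- by move=> x y _ _; apply: count_AL2.
- by move=> x _; apply: count_AL1.
Qed.

Lemma bibd_ALD : forms_bibd D [set M in AL | M \subset D]
  (2 ^ J.-1 * (2 ^ J + 1)) (2 ^ J)
  (\prod_(0 <= j < J.-1) (2 ^ j + 1)) (\prod_(0 <= j < J) (2 ^ j + 1))
  (\prod_(1 <= j < J.+1) (2 ^ j + 1)).
Proof.
apply: forms_bibdI.
- exact: cardD.
- by rewrite -{1}(expn1 2) leq_exp2l.
- exact: prod_gt0.
(* The factor at [j = 0] is 2 and turns [2 ^ J.-1] into [2 ^ J], while [2 ^ J + 1] becomes the last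
   factor of the other product. *)
- rewrite big_ltn // expn0 big_nat_recr //=.
  by case: J J0 => // j _ /=; rewrite expnS; ring.
- by move=> M; rewrite inE => /andP[aM ->]; rewrite card_affine_lagrangian.
- move=> x y xD yD xy; rewrite -(count_ALD2 xD yD xy).
  by apply: eq_card => M; rewrite !inE -andbA; case: (M \in AL) => //=; rewrite andbC -andbA.
- move=> x xD; rewrite -(count_ALD1 xD).
  by apply: eq_card => M; rewrite !inE -andbA; case: (M \in AL) => //=; rewrite andbC.
Qed.

Local Notation NL := [set M in AL | ~~ (M \subset D)].
Local Notation compDc := [set M :&: ~: D | M in AL & ~~ (M \subset D)].
Local Notation compD := [set M :&: D | M in AL & ~~ (M \subset D)].

Lemma card_fibre_compDc :
  {in NL, forall M0, #|[set M in NL | M :&: ~: D == M0 :&: ~: D]| = 3%N}.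
Proof.
move=> M0; rewrite inE => /andP[aM nM]; rewrite -(count_extensions aM nM).
by apply: eq_card => M; rewrite !inE -andbA.
Qed.

Lemma card_fibre_compD :
  {in NL, forall M0, #|[set M in NL | M :&: D == M0 :&: D]| = 1%N}.
Proof.
move=> M0 nM0; rewrite -[RHS](cards1 M0); apply: eq_card => M; rewrite in_set in_set1.
by apply/andP/eqP => [[nM /eqP/component_inj->]|->].
Qed.

Lemma subsetN_mem x (M : {set W}) : x \in ~: D -> x \in M -> ~~ (M \subset D).
Proof. by rewrite inE => xD xM; apply: contra xD => /subsetP->. Qed.

(** A block through a point off [D] never lies in [D], and each component comes from three blocks.
    So the counts are those for [AL] divided by 3, which is the factor [2 ^ 1 + 1] at [j = 1]. *)
Lemma bibd_compDc : forms_bibd (~: D) compDc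
  (2 ^ J.-1 * (2 ^ J - 1)) (2 ^ J.-1)
  (\prod_(2 <= j < J) (2 ^ j + 1)) (\prod_(2 <= j < J.+1) (2 ^ j + 1))
  ((2 ^ J - 1) * \prod_(2 <= j < J.+1) (2 ^ j + 1)).
Proof.
have J1 : (1 < 2 ^ J)%N by rewrite -{1}(expn0 2) ltn_exp2l.
apply: forms_bibdI.
- have := cardsC D; rewrite cardD cardW.
  case: J J0 J1 => // j _ _ /=; rewrite mul2n -addnn expnD mulnBr.
  by rewrite !expnS; move: (2 ^ j)%N => a; lia.
- by case: J J2 => [|[|j]] //= _; rewrite expnS; have := expn_gt0 2 j; lia.
- by rewrite muln_gt0 subn_gt0 J1 prod_gt0.
- by rewrite -mulnA mulnC.
- move=> K /imsetP[M]; rewrite inE => /andP[aM nM] ->.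
  by rewrite subsetIr; have [_ ->] := card_component aM nM.
- move=> x y xD yD xy; apply/eqP; rewrite -(eqn_pmul2r (isT : 0 < 3)%N).
  rewrite (card_imset_fibres_cond (fun K : {set W} => (x \in K) && (y \in K)) card_fibre_compDc).
  rewrite mulnC -(@big_ltn _ _ _ 1 J (fun j => 2 ^ j + 1)%N) // -(count_AL2 xy).
  apply/eqP/eq_card => M; rewrite in_set [RHS]in_set in_set -andbA.
  case: (M \in AL) => //=; rewrite !in_setI xD yD !andbT andb_idl //.
  by case/andP=> xM _; apply: subsetN_mem xM.
- move=> x xD; apply/eqP; rewrite -(eqn_pmul2r (isT : 0 < 3)%N).
  rewrite (card_imset_fibres_cond (fun K : {set W} => (x \in K)) card_fibre_compDc).
  rewrite mulnC -(@big_ltn _ _ _ 1 J.+1 (fun j => 2 ^ j + 1)%N) // -(count_AL1 x).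
  apply/eqP/eq_card => M; rewrite in_set [RHS]in_set in_set -andbA.
  case: (M \in AL) => //=; rewrite !in_setI xD !andbT andb_idl //.
  by move=> xM; apply: subsetN_mem xM.
Qed.

(** Components determine their blocks here, so the counts through points of [D] are those for [AL]
    minus those for blocks inside [D]: the factor [2 ^ J.-1 + 1], respectively [2 ^ J + 1], drops by
    2. *)
Lemma bibd_compD : forms_bibd D compD
  (2 ^ J.-1 * (2 ^ J + 1)) (2 ^ J.-1)
  ((2 ^ J.-1 - 1) * \prod_(1 <= j < J.-1) (2 ^ j + 1))
  ((2 ^ J - 1) * \prod_(1 <= j < J) (2 ^ j + 1))
  ((2 ^ J - 1) * \prod_(1 <= j < J.+1) (2 ^ j + 1)).
Proof.
have J1 : (1 < 2 ^ J)%N by rewrite -{1}(expn0 2) ltn_exp2l.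
apply: forms_bibdI.
- exact: cardD.
- by case: J J2 => [|[|j]] //= _; rewrite expnS; have := expn_gt0 2 j; lia.
- by rewrite muln_gt0 subn_gt0 J1 prod_gt0.
- by rewrite [in RHS]big_nat_recr //=; ring.
- move=> K /imsetP[M]; rewrite inE => /andP[aM nM] ->.
  by rewrite subsetIr; have [-> _] := card_component aM nM.
- move=> x y xD yD xy; rewrite -[LHS]muln1.
  rewrite (card_imset_fibres_cond (fun K : {set W} => (x \in K) && (y \in K)) card_fibre_compD).
  have := cardsID [set M : {set W} | M \subset D] [set M in AL | (x \in M) && (y \in M)].
  rewrite count_AL2 // (_ : _ :&: _ = [set M in AL | [&& x \in M, y \in M & M \subset D]]).
    rewrite count_ALD2 // => cxy.
    rewrite (_ : [set M in NL | _] =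
      [set M in AL | (x \in M) && (y \in M)] :\: [set M : {set W} | M \subset D]).
      move: cxy; case: J J2 => [|[|j]] //= _.
      rewrite [in RHS]big_nat_recr //= [X in (X + _)%N = _]big_ltn // expn0.
      move: (\prod_(1 <= i < j.+1) _)%N (2 ^ j.+1)%N #|_ :\: _| => p e N.
      by rewrite mulnBl; lia.
    apply/setP => M; rewrite in_set in_setD in_set [in RHS]in_set [in RHS]in_set.
    by rewrite !in_setI xD yD !andbT andbAC andbC.
  apply/setP => M; rewrite in_setI !in_set -!andbA; case: (M \in AL) => //=.
- move=> x xD; rewrite -[LHS]muln1.
  rewrite (card_imset_fibres_cond (fun K : {set W} => (x \in K)) card_fibre_compD).
  have := cardsID [set M : {set W} | M \subset D] [set M in AL | x \in M].
  rewrite count_AL1 // (_ : _ :&: _ = [set M in AL | (x \in M) && (M \subset D)]).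
    rewrite count_ALD1 // => cxy.
    rewrite (_ : [set M in NL | _] =
      [set M in AL | x \in M] :\: [set M : {set W} | M \subset D]).
      move: cxy; rewrite [X in (X + _)%N = _]big_ltn // expn0 big_nat_recr //=.
      move: (\prod_(1 <= i < J) _)%N (2 ^ J)%N #|_ :\: _| => p e N.
      by rewrite mulnBl; lia.
    apply/setP => M; rewrite in_set in_setD in_set [in RHS]in_set [in RHS]in_set.
    by rewrite !in_setI xD !andbT andbAC andbC.
  apply/setP => M; rewrite in_setI !in_set -!andbA; case: (M \in AL) => //=.
Qed.

(** Existence: if every coset met the complement of [D], all coset sums would vanish by
    [coset_sum0], yet their total over all translations is [2 ^ J * 2 ^ J]. Uniqueness: [u + L]
    inside [D] prescribes [B l u = q l + q 0] on [L], which fixes [u] modulo [orthocomp B L = L]. *)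
Lemma unique_coset L : lagrangian B L ->
  exists! M : {set W}, (exists v, M = translate v L) /\ M \subset D.
Proof.
move=> lL; have sL := lagrangian_subspace lL.
have [v vD] : exists v, translate v L \subset D.
  case: (pselect (exists v, translate v L \subset D)) => // noL'.
  have noL v : ~~ (translate v L \subset D) by apply/negP => vD; apply: noL'; exists v.
  exfalso.
  have sum0 v : \sum_(x in L) sg int (q (v + x)) = 0.
    have := noL v; move/(mem_affine_nsubset (mem_affine_lagrangian v lL)) => [w wL qw].
    rewrite -[RHS](coset_sum0 lL qw) [RHS](reindex_inj (addrI (v + w))) /=.
    apply: eq_big => x; first by rewrite subspace_addl // -mem_translate.
    by move=> _; rewrite [v + w]addrC -addrA vaddKv.
  have : \sum_(v : W) \sum_(x in L) sg int (q (v + x)) = 0 by apply: big1.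
  rewrite exchange_big /= (eq_bigr (fun=> 2 ^+ J)); last first.
    by move=> x _; rewrite -(sum_sgq int) [RHS](reindex_inj (addIr x)).
  rewrite sumr_const card_lagrangian // => /eqP.
  by rewrite mulrn_eq0 !expn_eq0 expf_eq0 /= !andbF.
exists (translate v L); split; first by split=> //; exists v.
move=> _ [[w ->] wD].
have iL := lagrangian_isotropic lL.
have lin u l : translate u L \subset D -> l \in L -> B l u = q l + q 0.
  move=> uD lL'; have /singularP[_ qu] : singular u L by rewrite /singular iL.
  have := qu l lL'; rewrite quadD BC.
  have -> : q u = 0 by rewrite -[u]addr0 qu //; case/subspaceP: sL.
  by case: (F2P (B l u)); case: (F2P (q l)); case: (F2P (q 0))
    => -> -> -> /eqP // _; apply: val_inj.
apply: translate_id => //; rewrite mem_translate -(eqP lL); apply/orthocompP => l lL'.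
by rewrite BDr !lin // F2_addbb.
Qed.

(** * Sets of points with isotropic differences *)

Definition difference_isotropic (K : {set W}) :=
  {in K & &, forall a b c, B (a + b) (b + c) = 0}.

(** The double orthogonal complement of [translate b K] stands in for the span of the differences.
    It is isotropic, and some Lagrangian subspace contains it because the product in
    [count_lagrangian] is positive. *)
Lemma difference_isotropicP (K : {set W}) : K != set0 ->
  difference_isotropic K <-> exists2 M, M \in AL & K \subset M.
Proof.
move=> /set0Pn[b bK]; split=> [hK|[M aM KM] x y z xK yK zK]; last first.
  have yM := subsetP KM _ yK; move: aM; rewrite (affine_lagrangianE yM) => lM.
  have xM : x + y \in translate y M.
    by rewrite mem_translate [x + y]addrC vaddKv (subsetP KM).
  have zM : y + z \in translate y M by rewrite mem_translate vaddKv (subsetP KM).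
  by move: zM; rewrite -{1}(eqP lM) => /orthocompP/(_ _ xM).
pose P := orthocomp B (translate b K); pose S := orthocomp B P.
have KP : translate b K \subset P.
  apply/subsetP => y; rewrite mem_translate => yK; apply/orthocompP => x.
  rewrite mem_translate => xK; have := hK _ _ _ xK bK yK.
  by rewrite vaddKv addrC vaddKv.
have iS : isotropic S.
  rewrite /isotropic subspace_orthocomp (subset_trans (orthocompS KP)) //.
  exact: orthocompK_sub.
have /andP[sS SS] := iS.
(* The size of [S] divides a power of 2, so it is one; isotropy then bounds the exponent by [J]. *)
have [k kJ cS] : exists2 k, (k <= 2 * J)%N & #|S| = (2 ^ k)%N.
  by apply/(dvdn_pfactor _ _ (isT : prime 2)); rewrite -cardW -(card_orthocomp sS) dvdn_mulr.
have {}kJ : (k <= J)%N.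
  have : (2 ^ k * 2 ^ k <= 2 ^ (2 * J))%N.
    by rewrite -cardW -(card_orthocomp sS) -cS leq_mul2l subset_leq_card ?orbT.
  by rewrite -expnD leq_exp2l // addnn -mul2n leq_pmul2l.
have := count_lagrangian kJ iS cS; set F := [set L | _] => cF.
have /set0Pn[L] : F != set0 by rewrite -card_gt0 cF prod_gt0.
rewrite inE => /andP[lL SL]; exists (translate b L).
  exact: mem_affine_lagrangian.
apply/subsetP => y yK; rewrite mem_translate; apply: (subsetP SL).
by apply: (subsetP (orthocompK_sub _)); rewrite mem_translate vaddKv.
Qed.

Lemma difference_isotropic_lagrangian (K : {set W}) : #|K| = (2 ^ J)%N ->
  difference_isotropic K <-> K \in AL.
Proof.
move=> cK; have K0 : K != set0 by rewrite -card_gt0 cK expn_gt0.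
rewrite (difference_isotropicP K0); split=> [[M aM KM]|aK]; last by exists K.
suff -> : K = M by [].
by apply/eqP; rewrite eqEcard KM cK card_affine_lagrangian ?leqnn.
Qed.

Lemma difference_isotropic_compDc (K : {set W}) : K \subset ~: D ->
  #|K| = (2 ^ J.-1)%N -> difference_isotropic K <-> K \in compDc.
Proof.
move=> KD cK; have K0 : K != set0 by rewrite -card_gt0 cK expn_gt0.
rewrite (difference_isotropicP K0); split=> [[M aM KM]|/imsetP[M]].
  have nM : ~~ (M \subset D).
    have [x xK] := set0Pn _ K0.
    exact: subsetN_mem (subsetP KD _ xK) (subsetP KM _ xK).
  apply/imsetP; exists M; first by rewrite inE aM.
  apply/eqP; rewrite eqEcard subsetI KM KD cK.
  by have [_ ->] := card_component aM nM; rewrite leqnn.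
by rewrite inE => /andP[aM _] ->; exists M; rewrite ?subsetIl.
Qed.

(** * Gram matrices of the frames *)

Section Frames.
Variable R : realType.

(** The indicator of [~: D] is half of 1 minus the sign of [q], so the sum is half the difference of
    a full character sum and [sum_sgq_char]. *)
Lemma sum_sgB_compl z : \sum_(u in ~: D) sg R (B u z) =
  2 ^+ J.-1 * (2 ^+ J * (z == 0)%:R - sg R (q z + q 0)).
Proof.
have total : \sum_(u : W) sg R (B u z) = 2 ^+ J * 2 ^+ J * (z == 0)%:R.
  under eq_bigl => u do rewrite -(in_setT u).
  rewrite sum_sgB; last by apply/subspaceP; split=> [|? ? _ _]; rewrite inE.
  rewrite orthocompT in_set1 cardsT cardW mul2n -addnn expnD natrM natrX.
  by case: eqP => _; rewrite ?mulr1 ?mulr0.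
have two (x : R) : 2 * (2 ^+ J.-1 * x) = 2 ^+ J * x.
  by rewrite mulrA -exprS prednK.
apply: (mulfI (_ : 2 != 0 :> R)); first by rewrite pnatr_eq0.
rewrite two mulrBr mulrA -total -sum_sgq_char -sumrB mulr_sumr big_mkcond /=.
apply: eq_bigr => u _; rewrite inE inE BC.
by case: (F2P (q u)) => ->; rewrite /= ?sg0 ?sg1; ring.
Qed.

Lemma psi_gram a b : dotp (psi B R J D a) (psi B R J D b) =
  (2 ^ J)%:R * (a == b)%:R - sg R (q (a + b) + q 0).
Proof.
set x : R := - (J%:R - 1) / 2.
have c2 : 2 `^ x * 2 `^ x * 2 ^+ J.-1 = 1.
  rewrite -powR_mulrn // -!powRD ?pnatr_eq0 ?implybT //.
  rewrite (_ : x + x + J.-1%:R = 0) ?powRr0 //.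
  have -> : J.-1%:R = J%:R - 1 :> R by rewrite -{2}(prednK J0) -natr1 addrK.
  by rewrite /x; field.
rewrite /dotp.
under eq_bigr => u _ do rewrite !ffunE -/x mulrACA -sgD -BDr.
rewrite -mulr_sumr -(big_sub (~: D) (fun u => sg R (B u (a + b)))) sum_sgB_compl.
by rewrite mulrA c2 mul1r vadd_eq0 natrX.
Qed.

Lemma sgDD_eq (x y z : 'F_2) : sg R x = sg R y * sg R z <-> x = y + z.
Proof. by rewrite -sgD; split=> [/sg_inj|->]. Qed.

Lemma regular_simplex_psi (K : {set W}) :
  regular_simplex (@dotp R _) (psi B R J D) K <-> K \in AL.
Proof.
pose eps a b := sg R (q (a + b) + q 0).
have n2 : (2 <= 2 ^ J)%N by rewrite -{1}(expn1 2) leq_exp2l.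
have gram : {in K &, forall a b, dotp (psi B R J D a) (psi B R J D b) =
   (2 ^ J)%:R * (a == b)%:R - eps a b} by move=> a b _ _; apply: psi_gram.
have eps2 : {in K &, forall a b, eps a b ^+ 2 = 1}.
  by move=> a b _ _; rewrite expr2 sg_mul.
have eps1 : {in K, forall a, eps a a = 1}.
  by move=> a _; rewrite /eps vaddvv F2_addbb.
(* As [a + b + (b + c) = a + c], this is [hq] at [a + b] and [b + c]. *)
have epsP a b c : eps a c = eps a b * eps b c <-> B (a + b) (b + c) = 0.
  rewrite sgDD_eq hq (_ : a + b + (b + c) = a + c); last by rewrite -addrA vaddKv.
  by case: (F2P (q (a + c))); case: (F2P (q (a + b))); case: (F2P (q (b + c)));
    case: (F2P (q 0)) => -> -> -> ->; split=> /eqP h; apply/eqP; move: h.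
split=> [/(regular_simplex_eps n2 gram eps2 eps1)[cK epsM]|aK].
  apply/(difference_isotropic_lagrangian cK) => a b c aK bK cK'.
  by apply/epsP/epsM.
have cK := card_affine_lagrangian aK.
have hK : difference_isotropic K by apply/(difference_isotropic_lagrangian cK).
apply: (eps_regular_simplex n2 gram eps2 eps1 cK) => a b c aK' bK cK'.
exact/epsP/hK.
Qed.

Lemma regular_simplex_hatphi (H : lmodType R) (ip : {dot H for idfun})
    (hatphi : W -> H) (K : {set W}) :
  hatphi_gram B J D ip hatphi -> K \subset ~: D ->
  regular_simplex ip hatphi K <-> K \in compDc.
Proof.
move=> hgram KD.
pose eps a b := sg R (B a b).
have n2 : (2 <= 2 ^ J.-1)%N.
  by rewrite -{1}(expn1 2) leq_exp2l // -ltnS prednK.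
have gram : {in K &, forall a b, ip (hatphi a) (hatphi b) =
   (2 ^ J.-1)%:R * (a == b)%:R - eps a b}.
  move=> a b /(subsetP KD) aD /(subsetP KD) bD; rewrite hgram //.
  have [->|_] := eqVneq a b; last by rewrite mulr0 add0r.
  by rewrite /eps Bvv mulr1 natrX.
have eps2 : {in K &, forall a b, eps a b ^+ 2 = 1}.
  by move=> a b _ _; rewrite expr2 sg_mul.
have eps1 : {in K, forall a, eps a a = 1} by move=> a _; rewrite /eps Bvv.
have epsP a b c : eps a c = eps a b * eps b c <-> B (a + b) (b + c) = 0.
  rewrite sgDD_eq BDl !(BDr _ _ a) !(BDr _ _ b) Bvv.
  by case: (F2P (B a c)); case: (F2P (B a b)); case: (F2P (B b c))
    => -> -> ->; split=> /eqP h; apply/eqP; move: h.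
split=> [/(regular_simplex_eps n2 gram eps2 eps1)[cK epsM]|aK].
  apply/(difference_isotropic_compDc KD cK) => a b c aK bK cK'.
  by apply/epsP/epsM.
have cK : #|K| = (2 ^ J.-1)%N.
  case/imsetP: aK => M; rewrite inE => /andP[aM nM] ->.
  by have [_ ->] := card_component aM nM.
have hK : difference_isotropic K by apply/(difference_isotropic_compDc KD cK).
apply: (eps_regular_simplex n2 gram eps2 eps1 cK) => a b c aK' bK cK'.
exact/epsP/hK.
Qed.

End Frames.

(** * The block form of the incidence matrix *)

Lemma card_AL_split :
  #|AL| = (#|compDc| * 3 + #|[set M in AL | M \subset D]|)%N.
Proof.
rewrite -(card_imset_fibres card_fibre_compDc).
rewrite -[LHS](cardsID [set M : {set W} | M \subset D]) addnC; congr (_ + _)%N.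
  by apply: eq_card => M; rewrite in_setD [RHS]in_set in_set andbC.
by apply: eq_card => M; rewrite in_setI [RHS]in_set in_set.
Qed.

Lemma incidence_arranged (R : nzRingType)
    (colDc : 'I_#|~: D| -> W) (colD : 'I_#|D| -> W)
    (row : 'I_(#|compDc| * 3 + #|[set M in AL | M \subset D]|) -> {set W}) :
  enumerates (~: D) colDc -> enumerates D colD ->
  enumerates AL row -> arranged_by (~: D) row ->
  exists (rowDc : 'I_#|compDc| -> {set W})
         (row0 : 'I_(#|compDc| * 3) -> {set W})
         (rowD : 'I_#|[set M in AL | M \subset D]| -> {set W}),
    [/\ enumerates compDc rowDc,
        enumerates compD row0,
        enumerates [set M in AL | M \subset D] rowD &
        incidence R row (concat colDc colD) =
        block_mx
          (castmx (erefl _, muln1 _)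
             (incidence R rowDc colDc *t const_mx (m := 3) (n := 1) 1))
          (incidence R row0 colD)
          0
          (incidence R rowD colD)].
Proof.
move=> [colDc_inj colDcE] [colD_inj colDE] [row_inj rowE] [row_first row_conv].
set m := #|compDc| in row row_inj rowE row_first row_conv *.
set p := #|[set M in AL | M \subset D]| in row row_inj rowE row_first row_conv *.
have rowAL i : row i \in AL by rewrite -rowE imset_f.
have rowP M : M \in AL -> exists i, M = row i.
  by rewrite -rowE => /imsetP[i _ ->]; exists i.
have meet0 i : (row i :&: ~: D != set0) = ~~ (row i \subset D).
  by rewrite -setDE setD_eq0.
(* Rows meeting [~: D] form an initial segment, whose length is three times the number of
   components. *)
have firstE i : ~~ (row i \subset D) = (i < m * 3)%N.
  pose N := [set i | row i :&: ~: D != set0].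
  have cN : #|N| = (m * 3)%N.
    rewrite -[RHS](card_imset_fibres card_fibre_compDc) -[LHS](card_imset _ row_inj).
    apply: eq_card => M; apply/imsetP/idP => [[k]|].
      by rewrite !inE meet0 => nk ->; rewrite rowAL.
    rewrite inE => /andP[/rowP[k ->] nk]; exists k => //.
    by rewrite inE meet0.
  have := @initial_segmentE _ N _ i; rewrite cN inE meet0; apply.
  by move=> k l kl; rewrite !inE; apply: row_first.
pose rowL (i : 'I_(m * 3)) := row (lshift p i).
have rowL_inj : injective rowL by move=> i j /row_inj/lshift_inj.
have rowL_NL i : rowL i \in NL by rewrite inE rowAL firstE /= ltn_ord.
have rowLP M : M \in NL -> exists i, M = rowL i.
  rewrite inE => /andP[/rowP[i ->]]; rewrite firstE => im.
  by exists (Ordinal im); congr row; apply: val_inj.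
pose g i := rowL i :&: ~: D.
(* Equal components are consecutive and each occurs three times, so the index divided by 3
   determines the component. *)
have g_div : forall i j : 'I_(m * 3), (i %/ 3 = j %/ 3)%N -> g i = g j.
  apply: fibre_divn => // [i j k ijk|i].
    exact: row_conv.
  rewrite -[RHS](card_fibre_compDc (rowL_NL i)) -[LHS](card_imset _ rowL_inj).
  apply: eq_card => M; apply/imsetP/idP => [[j]|].
    by rewrite in_set => gj ->; rewrite in_set rowL_NL.
  by rewrite in_set => /andP[/rowLP[j ->] gj]; exists j; rewrite // in_set.
(* [mxtens_index (k, r)] has value [k * 3 + r], so the first row of the [k]-th triple represents it,
   in the row order of [*t]. *)
pose rowDc k := g (mxtens_index (k, ord0 : 'I_3)).
have rowDcE k r : g (mxtens_index (k, r)) = rowDc k.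
  by apply: g_div; rewrite /= !divnMDl // !divn_small.
have rowDc_im : [set rowDc k | k : 'I_m] = compDc.
  apply/setP => K; apply/imsetP/imsetP => [[k _ ->]|[M MN ->]].
    by exists (rowL (mxtens_index (k, ord0))).
  have [i ->] := rowLP M MN; case: (mxtens_indexP i) => k r.
  by exists k; rewrite // -(rowDcE k r).
exists rowDc, (fun i => rowL i :&: D), (fun i => row (rshift (m * 3) i)).
split.
- split=> //.
  (* [rowDc] maps ['I_m] onto [compDc], which has [m] elements, so it is injective. *)
  have /imset_injP inj : #|[set rowDc k | k in 'I_m]| == #|'I_m|.
    by rewrite card_ord -[X in _ == X]/(#|compDc|) -rowDc_im.
  by move=> i j; apply: inj.
- split=> [i j|].
    by move=> /component_inj ij; apply/rowL_inj/ij.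
  apply/setP => K; apply/imsetP/imsetP => [[i _ ->]|[M MN ->]].
    by exists (rowL i).
  by have [i ->] := rowLP M MN; exists i.
- split=> [i j /row_inj/rshift_inj//|].
  apply/setP => M; apply/imsetP/idP => [[i _ ->]|].
    by rewrite inE rowAL -[_ \subset _]negbK firstE /= ltnNge leq_addr.
  rewrite inE => /andP[/rowP[i ->]]; case: (split_ordP i) => j ->.
    by rewrite -[_ \subset _]negbK firstE /= ltn_ord.
  by move=> _; exists j.
apply/matrixP => i j; rewrite mxE.
have cL k : concat colDc colD (lshift _ k) = colDc k.
  by rewrite /concat (unsplitK (inl k)).
have cR k : concat colDc colD (rshift _ k) = colD k.
  by rewrite /concat (unsplitK (inr k)).
have colDc_mem k : colDc k \in ~: D by rewrite -colDcE imset_f.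
have colD_mem k : colD k \in D by rewrite -colDE imset_f.
case: (split_ordP i) => i' ->; case: (split_ordP j) => j' ->; rewrite ?cL ?cR.
- rewrite block_mxEul castmxE; case: (mxtens_indexP i') => k r.
  have -> : cast_ord (esym (muln1 _)) j' = mxtens_index (j', ord0).
    by apply: val_inj; rewrite /= muln1 addn0.
  rewrite cast_ord_id tensmxE !mxE mulr1 -(rowDcE k r) /g in_setI colDc_mem.
  by rewrite andbT.
- by rewrite block_mxEur mxE in_setI colD_mem andbT.
- rewrite block_mxEdl mxE; case: (boolP (_ \in _)) => // mem.
  have := firstE (rshift (m * 3) i'); rewrite /= ltnNge leq_addr /= => /negbFE.
  by move=> /subsetP/(_ _ mem); have := colDc_mem j'; rewrite inE => /negPf->.
- by rewrite block_mxEdr mxE.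
Qed.

End Quadric.
End Count.
End Form.
End Space.

(** For the complement of a quadric, [Q + 1] vanishes exactly on [D]. The term [q 0] absorbs the
    added constant, so both kinds of affine quadric obey one equation. *)
Lemma affine_quadricP (V : vectType 'F_2) (B : {biscalar (finvect_type V)})
    (D : {set finvect_type V}) : affine_quadric B D ->
  exists2 q : finvect_type V -> 'F_2,
    forall x y, B x y = q (x + y) + q x + q y + q 0 & D = [set x | q x == 0].
Proof.
case=> Q hQ DQ.
have Q0 : Q 0 = 0.
  have := hQ 0 0; rewrite linear0l addr0 F2_addbb add0r => <-.
  by [].
case: DQ => DE; [exists Q => // x y|exists (fun x => Q x + 1) => [x y|]].
- by rewrite Q0 addr0 hQ.
- rewrite Q0 hQ; case: (F2P (Q (x + y))); case: (F2P (Q x)); case: (F2P (Q y));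
    by move=> -> -> ->; apply: val_inj.
- rewrite -[D]setCK DE; apply/setP => x; rewrite !inE.
  by case: (F2P (Q x)) => ->.
Qed.

Theorem theorem5p9 (R : realType) (J : nat) (hJ : (2 <= J)%N)
    (V : vectType 'F_2) (hV : \dim {:V} = (2 * J)%N)
    (B : {biscalar (finvect_type V)}) (hB : symplectic B)
    (D : {set finvect_type V}) (hD : affine_quadric B D)
    (cardD : #|D| = (2 ^ J.-1 * (2 ^ J + 1))%N)
    (H : completeNormedModType R) (ip : {dot H for idfun})
    (hH : hilbert_inner ip)
    (hatphi : finvect_type V -> H) (hhatphi : hatphi_gram B J D ip hatphi) :
  let binPsi := binder (@dotp R _) (psi B R J D) [set: finvect_type V] in
  let binPsiD := binder (@dotp R _) (psi B R J D) D in
  let binHatPhi := binder ip hatphi (~: D) in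
  let compDc := [set M :&: ~: D | M in binPsi & ~~ (M \subset D)] in
  let compD := [set M :&: D | M in binPsi & ~~ (M \subset D)] in
  (* (1) *)
  (binPsi = affine_lagrangians B /\
   forms_bibd [set: finvect_type V] binPsi
     (2 ^ (2 * J)) (2 ^ J)
     (\prod_(1 <= j < J) (2 ^ j + 1))
     (\prod_(1 <= j < J.+1) (2 ^ j + 1))
     (2 ^ J * \prod_(1 <= j < J.+1) (2 ^ j + 1))) /\
  (* (2) *)
  ((forall L : {set finvect_type V}, lagrangian B L ->
      exists! M : {set finvect_type V},
        (exists v, M = translate v L) /\ M \subset D) /\
   binPsiD = [set M in binPsi | M \subset D] /\
   forms_bibd D binPsiD
     (2 ^ J.-1 * (2 ^ J + 1)) (2 ^ J)
     (\prod_(0 <= j < J.-1) (2 ^ j + 1))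
     (\prod_(0 <= j < J) (2 ^ j + 1))
     (\prod_(1 <= j < J.+1) (2 ^ j + 1))) /\
  (* (3) *)
  (forms_bibd (~: D) compDc
     (2 ^ J.-1 * (2 ^ J - 1)) (2 ^ J.-1)
     (\prod_(2 <= j < J) (2 ^ j + 1))
     (\prod_(2 <= j < J.+1) (2 ^ j + 1))
     ((2 ^ J - 1) * \prod_(2 <= j < J.+1) (2 ^ j + 1)) /\
   compDc = binHatPhi /\
   {in compDc, forall K : {set finvect_type V},
      #|[set M in binPsi :\: binPsiD | M :&: ~: D == K]| = 3%N}) /\
  (* (4) *)
  forms_bibd D compD
    (2 ^ J.-1 * (2 ^ J + 1)) (2 ^ J.-1)
    ((2 ^ J.-1 - 1) * \prod_(1 <= j < J.-1) (2 ^ j + 1))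
    ((2 ^ J - 1) * \prod_(1 <= j < J) (2 ^ j + 1))
    ((2 ^ J - 1) * \prod_(1 <= j < J.+1) (2 ^ j + 1)) /\
  (* (5) *)
  (forall (colDc : 'I_#|~: D| -> finvect_type V)
          (colD : 'I_#|D| -> finvect_type V),
     enumerates (~: D) colDc -> enumerates D colD ->
     let isArrangement
         (row : 'I_(#|compDc| * 3 + #|binPsiD|) -> {set finvect_type V}) :=
       enumerates binPsi row /\ arranged_by (~: D) row in
     (exists row, isArrangement row) /\
     forall row, isArrangement row ->
       exists (rowDc : 'I_#|compDc| -> {set finvect_type V})
              (row0 : 'I_(#|compDc| * 3) -> {set finvect_type V})
              (rowD : 'I_#|binPsiD| -> {set finvect_type V}),
         [/\ enumerates compDc rowDc,
             enumerates compD row0,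
             enumerates binPsiD rowD &
             incidence R row (concat colDc colD) =
             block_mx
               (castmx (erefl _, muln1 _)
                  (incidence R rowDc colDc *t const_mx (m := 3) (n := 1) 1))
               (incidence R row0 colD)
               0
               (incidence R rowD colD)]).
Proof.
have [q hq DE] := affine_quadricP hD; subst D.
have cardW : #|finvect_type V| = (2 ^ (2 * J))%N.
  have := @card_vspacef 'F_2 (finvect_type V) (Vector.class V).
  by rewrite card_vspace card_Fp // => <-; rewrite -hV.
have J0 : (0 < J)%N by apply: ltnW.
(* [regular_simplex_psi] covers every set [K] of points, so it yields the binder over the whole
   space and, in [e2], the one over [D]. *)
have e1 : binder (@dotp R _) (psi B R J [set x | q x == 0]) [set: finvect_type V]
    = affine_lagrangians B.
  apply/setP => K; rewrite inE subsetT /=.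
  by apply/asboolP/idP => /(regular_simplex_psi hB cardW hq J0 cardD).
have e2 : binder (@dotp R _) (psi B R J [set x | q x == 0]) [set x | q x == 0]
    = [set M in affine_lagrangians B | M \subset [set x | q x == 0]].
  apply/setP => K; rewrite [LHS]inE [RHS]inE andbC; congr (_ && _).
  by apply/asboolP/idP => /(regular_simplex_psi hB cardW hq J0 cardD).
have e3 : binder ip hatphi (~: [set x | q x == 0]) =
    [set M :&: ~: [set x | q x == 0] | M in affine_lagrangians B
      & ~~ (M \subset [set x | q x == 0])].
  apply/setP => K; rewrite [LHS]inE; apply/andP/idP => [[KD]|KC].
    by move/asboolP/(regular_simplex_hatphi hB cardW hq J0 cardD hJ hhatphi KD).
  have KD : K \subset ~: [set x | q x == 0].
    by case/imsetP: KC => M _ ->; apply: subsetIr.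
  split=> //; apply/asboolP.
  by apply/(regular_simplex_hatphi hB cardW hq J0 cardD hJ hhatphi KD).
move=> /=; rewrite e1 e2 e3.
split; [|split; [|split; [|split]]].
- by split=> //; apply: (bibd_AL hB cardW J0).
- split; first by move=> L; apply: (unique_coset hB cardW hq J0 cardD).
  by split=> //; apply: (bibd_ALD hB cardW hq J0 cardD).
- split; first exact: (bibd_compDc hB cardW hq J0 cardD hJ).
  split=> // K /imsetP[M MN ->].
  rewrite -(card_fibre_compDc hB cardW hq J0 cardD MN).
  apply: eq_card => M'; rewrite [LHS]in_set in_setD [RHS]in_set; congr (_ && _).
  by rewrite !in_set; case: (M' \in affine_lagrangians B); rewrite ?andbT.
- exact: (bibd_compD hB cardW hq J0 cardD hJ).
move=> colDc colD hDc hDD; split.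
  exact: (exists_arranged _ (esym (card_AL_split hB cardW hq J0 cardD))).
by move=> row [row1 row2]; apply: (incidence_arranged hB cardW hq J0 cardD).
Qed.
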